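(* For every $n$, the matrix $A_n=(a_{\lambda\mu})_{\lambda,\mu\in P_n}$ defined by $$S_\lambda(x,x)=\sum_{\mu\in P_n}a_{\lambda\mu}\,Q_{\mu^r}(x)\,S_{\mu^d}(x^2)\qquad(\lambda\in P_n)$$ is integral, i.e. all $a_{\lambda\mu}$ are integers.
   Context: $P_n$ is the set of partitions of $n$. For a partition $\lambda$ let $m_i(\lambda)$ be the multiplicity of $i$ as a part of $\lambda$. Define $\lambda^r$ to be the strict partition (distinct parts) with $m_i(\lambda^r)=1$ if $m_i(\lambda)$ is odd and $0$ if $m_i(\lambda)$ is even. Define $\lambda^d$ to be the partition with $m_i(\lambda^d)=\frac12(m_i(\lambda)-1)$ if $m_i(\lambda)$ is odd and $\frac12 m_i(\lambda)$ if $m_i(\lambda)$ is even. $S_\nu(x)$ is the ordinary Schur function in $x=(x_1,x_2,\ldots)$. We write $(x,x)=(x_1,x_1,x_2,x_2,\ldots)$ and $x^2=(x_1^2,x_2^2,\ldots)$; thus $S_\lambda(x,x)$ is obtained from $S_\lambda$ by replacing each power sum $p_j$ by $2p_j(x)$, and $S_\nu(x^2)$ by replacing each $p_j$ by $p_{2j}(x)$. For a strict partition $\mu$, $Q_\mu(x)$ is Schur's $Q$-function (the Hall–Littlewood function $Q_\mu(x;t)$ at $t=-1$, in the standard normalization of Macdonald's book). The functions $Q_{\mu^r}(x)S_{\mu^d}(x^2)$, $\mu\in P_n$, form a basis (the ''compound basis'') of the space of homogeneous symmetric functions of degree $n$ over $\mathbb{C}$, so the $a_{\lambda\mu}$ are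 well defined. *)

(* Defs.v *)
From HB Require Import structures.
From mathcomp Require Import all_boot all_order all_fingroup all_algebra.
From mathcomp Require Import mpoly.

Set Implicit Arguments.
Unset Strict Implicit.
Unset Printing Implicit Defensive.

Import GRing.Theory.
Local Open Scope ring_scope.

(* A partition is the weakly decreasing list of its nonzero parts. *)
Definition is_partition (n : nat) (la : seq nat) : bool :=
  [&& sorted geq la, 0%N \notin la & sumn la == n].

(* P_n: a partition of n is stored padded with zeros to length n. *)
Record intpart (n : nat) : Type := IntPart {
  padded : n.-tuple 'I_n.+1;
  _ : sorted geq (map val padded) && (sumn (map val padded) == n)
}.

HB.instance Definition _ n := [isSub for @padded n].
HB.instance Definition _ n := [Finite of intpart n by <:].

Definition parts (n : nat) (la : intpart n) : seq nat :=
  [seq i <- map val (padded la) | (0 < i)%N].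
Coercion parts : intpart >-> seq.

Lemma parts_partition n (la : intpart n) : is_partition n la.
Proof.
case: la => t t_ok; have /andP[st /eqP sumt] := t_ok.
rewrite /parts /=; apply/and3P; split.
- by apply: sorted_filter => // y x z /= yx zy; apply: leq_trans zy yx.
- by rewrite mem_filter.
- by apply/eqP; rewrite -[RHS]sumt; elim: (map _ _) => //= -[|i] s <-.
Qed.

Lemma parts_onto n (s : seq nat) :
  is_partition n s -> exists la : intpart n, parts la = s.
Proof.
move=> /and3P[s_sorted s_pos /eqP s_sum].
have le_size : (size s <= n)%N.
  rewrite -s_sum; elim: s s_pos {s_sorted s_sum} => //= i s IHs.
  rewrite inE negb_or eq_sym -lt0n => /andP[i_gt0 /IHs].
  by move/(leq_add i_gt0); rewrite add1n.
have le_n i : i \in s -> (i <= n)%N.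
  rewrite -s_sum; elim: s {s_sorted s_pos s_sum le_size} => //= j s IHs.
  rewrite inE => /predU1P[->|/IHs le_i]; first exact: leq_addr.
  exact: leq_trans le_i (leq_addl _ _).
pose t := [seq inord i : 'I_n.+1 | i <- s ++ nseq (n - size s) 0%N].
have t_size : size t == n by rewrite size_map size_cat size_nseq subnKC.
have t_val : map val (Tuple t_size) = s ++ nseq (n - size s) 0%N.
  rewrite /= -map_comp -[RHS]map_id; apply/eq_in_map => i /=.
  rewrite mem_cat mem_nseq => /orP[/le_n le_i|/andP[_ /eqP->]].
    by rewrite inordK.
  by rewrite inordK.
have geq_trans : transitive geq by move=> y x z /= yx zy; apply: leq_trans zy yx.
have t_ok : sorted geq (map val (Tuple t_size))
            && (sumn (map val (Tuple t_size)) == n).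
  rewrite t_val sumn_cat sumn_nseq mul0n addn0 s_sum eqxx andbT.
  rewrite sorted_pairwise // pairwise_cat -!sorted_pairwise // s_sorted /=.
  apply/andP; split.
    by apply/allrelP=> i j _; rewrite mem_nseq => /andP[_ /eqP->].
  by elim: (n - size s)%N => //= -[|k].
exists (IntPart t_ok); rewrite /parts [padded _]/=.
rewrite t_val filter_cat; have -> : [seq i <- nseq (n - size s) 0%N | (0 < i)%N] = [::].
  by elim: (n - size s)%N.
rewrite cats0; apply/all_filterP/allP=> i si.
by rewrite lt0n; apply: contraNneq s_pos => <-.
Qed.

(* la^r and la^d; [undup] keeps one copy of each part, in decreasing order. *)
Definition part_r (la : seq nat) : seq nat :=
  [seq i <- undup la | odd (count_mem i la)].
Definition part_d (la : seq nat) : seq nat :=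
  flatten [seq nseq (count_mem i la)./2 i | i <- undup la].

(* h_k(x) = sum of x_(i_1) ... x_(i_k) over i_1 <= ... <= i_k. *)
Definition hsym (R : comPzRingType) N (x : N.-tuple R) (k : nat) : R :=
  \sum_(t : k.-tuple 'I_N | sorted leq (map val t)) \prod_(i <- t) tnth x i.

(* Schur polynomial of the alphabet x by the Jacobi-Trudi formula
   det (h_(la_i + j - i)), with h_k = 0 for k < 0. See [schur_alternant] for
   the agreement with the quotient of alternants (for size la <= N). *)
Definition schur (R : comPzRingType) N (x : N.-tuple R) (la : seq nat) : R :=
  \det (\matrix_(i < size la, j < size la)
    if (i <= nth 0%N la i + j)%N then hsym x (nth 0%N la i + j - i) else 0).

Lemma hsym0 (R : comPzRingType) N (x : N.-tuple R) : hsym x 0 = 1.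
Proof.
rewrite /hsym (big_pred1 [tuple]) ?big_nil // => t.
by rewrite [t]tuple0 /= eqxx.
Qed.

Lemma hsym_nil (R : comPzRingType) (x : 0.-tuple R) k : hsym x k.+1 = 0.
Proof. by rewrite /hsym big1 // => t; case: (thead t). Qed.

Lemma hsym_cons (R : comPzRingType) N y (x : N.-tuple R) k :
  hsym [tuple of y :: x] k.+1 = hsym x k.+1 + y * hsym [tuple of y :: x] k.
Proof.
have leq_tr : transitive leq by exact: leq_trans.
rewrite {1}/hsym (bigID (fun t => thead t == ord0)) /= addrC; congr (_ + _).
  pose f (t : k.+1.-tuple 'I_N) := [tuple of map (lift ord0) t].
  have f_inj : injective f.
    move=> s t /(congr1 val) /= /inj_map st; apply/val_inj/st.
    exact: lift_inj.
  have f_sorted t : sorted leq (map val (f t)) = sorted leq (map val t).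
    have -> : map val (f t) = map S (map val t).
      by rewrite -!map_comp; apply: eq_map => i; rewrite /= /bump.
    by rewrite sorted_map.
  rewrite (eq_bigl (fun t => t \in f @: [set s : k.+1.-tuple 'I_N | sorted leq (map val s)])); last first.
    move=> t; apply/idP/imsetP => [/andP[t_sorted t0]|[s]]; last first.
      by rewrite inE => s_sorted ->; rewrite f_sorted s_sorted /thead tnth_map.
    have [i0 t0' | t0'] := unliftP ord0 (thead t); last by rewrite t0' in t0.
    pose s := [tuple odflt i0 (unlift ord0 (tnth t i)) | i < k.+1].
    have t_eq : t = f s.
      apply/eq_from_tnth => i; rewrite tnth_map tnth_mktuple.
      case: unliftP => //= ti0; exfalso; move: t_sorted.
      case/tupleP: t {t0} t0' i ti0 {s} => y0 t; rewrite theadE => -> i.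
      rewrite /= path_sortedE // => ti0 /andP[/allP ge0 _].
      case: (unliftP ord0 i) ti0 => [j ->|->]; last first.
        by rewrite tnth0 => /(congr1 val).
      rewrite tnthS => tj0; suff /ge0 : 0%N \in map val t by [].
      by apply/mapP; exists (tnth t j); rewrite ?mem_tnth ?tj0.
    by exists s => //; rewrite inE -f_sorted -t_eq.
  rewrite big_imset /=; last by move=> s t _ _ /f_inj.
  rewrite /hsym; apply: eq_big => [t|t _]; first by rewrite inE.
  by rewrite big_map; apply: eq_bigr => i _; rewrite tnthS.
rewrite /hsym mulr_sumr.
rewrite (reindex (fun t : k.-tuple 'I_N.+1 => [tuple of ord0 :: t])) /=; last first.
  exists (fun t : k.+1.-tuple _ => [tuple of behead t]) => t.
    by move=> _; apply/val_inj.
  case/tupleP: t => i t; rewrite inE theadE => /andP[_ /eqP->].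
  exact/val_inj.
apply: eq_big => [t|t _]; last by rewrite big_cons tnth0.
rewrite theadE eqxx andbT path_sortedE //.
by rewrite (_ : all _ _) //; apply/allP.
Qed.

Section Alternant.
Variable R : comPzRingType.
Implicit Types (f g c : nat -> R) (s : seq R) (y : R).

Let dlt0 : nat -> R := fun a => (a == 0)%:R.
Let shift f : nat -> R := fun a => if a is b.+1 then f b else 0.
Let D y f : nat -> R := fun a => f a - y * shift f a.
Let Ds s f : nat -> R := foldr D f s.
Let conv c f : nat -> R := fun a => \sum_(r < a.+1) c r * f (a - r)%N.

Let eq_D y f g : f =1 g -> D y f =1 D y g.
Proof. by move=> fg [|a]; rewrite /D /= !fg. Qed.

Let eq_Ds s f g : f =1 g -> Ds s f =1 Ds s g.
Proof. by elim: s => //= y s IHs /IHs; apply: eq_D. Qed.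

Let DC y z f : D y (D z f) =1 D z (D y f).
Proof.
case=> [|a]; rewrite /D /= ?mulr0 ?subr0 // !mulrBr !mulrA (mulrC z y).
by rewrite !opprB !addrA addrAC [RHS]addrAC; congr (_ + _); apply: addrAC.
Qed.

Let D_Ds y s f : D y (Ds s f) =1 Ds s (D y f).
Proof.
elim: s => //= z s IHs a; rewrite DC; exact: eq_D.
Qed.

Let D_inj y f g : D y f =1 D y g -> f =1 g.
Proof.
move=> Dfg; elim=> [|a IHa]; have := Dfg; first by move/(_ 0%N); rewrite /D /= mulr0 !subr0.
by move/(_ a.+1); rewrite /D /= IHa => /addIr.
Qed.

Let conv_Dl y c f : conv (D y c) f =1 D y (conv c f).
Proof.
move=> a; rewrite /conv /D.
under eq_bigr do rewrite mulrBl -mulrA.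
rewrite sumrB -mulr_sumr; congr (_ - y * _).
rewrite big_ord_recl /= mul0r add0r; case: a => [|a] /=; first by rewrite big_ord0.
by apply: eq_bigr.
Qed.

Let conv_Dsl s c f : conv (Ds s c) f =1 Ds s (conv c f).
Proof. by elim: s => //= y s IHs a; rewrite conv_Dl; apply: eq_D. Qed.

Let conv_dlt0 f : conv dlt0 f =1 f.
Proof.
move=> a; rewrite /conv big_ord_recl /= subn0 mul1r big1 ?addr0 // => i _.
by rewrite mul0r.
Qed.

Let Ds_big s a : (size s < a)%N -> Ds s dlt0 a = 0.
Proof.
elim: s a => [|y s IHs] [|a] //= lt_s.
by rewrite /D /= !IHs ?mulr0 ?subr0 // ltnW.
Qed.

Let D_pow y : D y (fun a => y ^+ a) =1 dlt0.
Proof. by case=> [|a]; rewrite /D /= ?mulr0 ?subr0 // exprS subrr. Qed.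

Let Ds_hsym N (x : N.-tuple R) : Ds x (hsym x) =1 dlt0.
Proof.
elim: N x => [|N IHN] x.
  by rewrite [x]tuple0 => -[|a] /=; rewrite ?hsym0 ?hsym_nil.
case/tupleP: x => y x a /=; rewrite D_Ds -(IHN x); apply: eq_Ds => -[|b].
  by rewrite /D /= mulr0 subr0 !hsym0.
by rewrite /D /= hsym_cons addrK.
Qed.

Let Ds_perm s1 s2 f : perm_eq s1 s2 -> Ds s1 f =1 Ds s2 f.
Proof.
elim: s1 s2 => [|y s1 IHs] s2; first by rewrite perm_sym => /perm_nilP->.
move=> s12; have ys2 : y \in s2 by rewrite -(perm_mem s12) mem_head.
case/splitPr: ys2 s12 => u v.
rewrite perm_sym -[y :: v]cat1s perm_catCA /= perm_cons perm_sym => /IHs uv a /=.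
rewrite (eq_D _ uv) /Ds !foldr_cat /=.
exact: (D_Ds y u).
Qed.

Let rest N (x : N.-tuple R) (k : 'I_N) := rem (tnth x k) x.

Let key N (x : N.-tuple R) (k : 'I_N) a :
  \sum_(r < N | (r <= a)%N) Ds (rest x k) dlt0 r * hsym x (a - r)
  = tnth x k ^+ a.
Proof.
have xk := mem_tnth k x.
suff <- : conv (Ds (rest x k) dlt0) (hsym x) a = tnth x k ^+ a.
  have sz : (size (rest x k)).+1 = N.
    by rewrite size_rem // size_tuple prednK //; case: (k) => i /=; case: (N).
  rewrite /conv (big_ord_widen_cond (maxn N a.+1) xpredT
     (fun r => Ds (rest x k) dlt0 r * hsym x (a - r))) ?leq_maxr //.
  rewrite (big_ord_widen_cond (maxn N a.+1) (fun r => r <= a)%N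
     (fun r => Ds (rest x k) dlt0 r * hsym x (a - r))) ?leq_maxl //.
  rewrite [RHS](bigID (fun r : 'I__ => (r < N)%N)) /= [X in _ = _ + X]big1 ?addr0 //.
  by move=> r /andP[_]; rewrite -leqNgt => le_r; rewrite Ds_big ?mul0r // sz.
rewrite conv_Dsl (eq_Ds _ (conv_dlt0 _)).
move: a; apply: (@D_inj (tnth x k)) => a; rewrite D_pow.
rewrite -[LHS]/(Ds (tnth x k :: rest x k) _ a).
by rewrite -(Ds_perm _ (perm_to_rem xk)) Ds_hsym.
Qed.

Let hmx N (x : N.-tuple R) (al : 'I_N -> nat) : 'M[R]_N :=
  \matrix_(i, j) if (N.-1 - j <= al i)%N then hsym x (al i - (N.-1 - j)) else 0.

Let alternant_det N (x : N.-tuple R) : {c : R | forall al : 'I_N -> nat,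
  \det (\matrix_(i < N, k < N) tnth x k ^+ al i) = \det (hmx x al) * c}.
Proof.
exists (\det (\matrix_(j < N, k < N) Ds (rest x k) dlt0 (N.-1 - j))) => al.
rewrite -det_mulmx; congr (\det _); apply/matrixP=> i k; rewrite !mxE -key.
rewrite big_mkcond [LHS](reindex_inj rev_ord_inj) /=.
apply: eq_bigr => j _; rewrite !mxE.
have -> : (N - j.+1 = N.-1 - j)%N by rewrite -subn1 -subnDA add1n.
by case: ifP => _; rewrite ?mul0r // mulrC.
Qed.


Let jacobi_trudi_widen (h : nat -> R) (la : seq nat) N :
  h 0%N = 1 -> (size la <= N)%N ->
  let JT n := \det (\matrix_(i < n, j < n)
    if (i <= nth 0%N la i + j)%N then h (nth 0%N la i + j - i)%N else 0) in
  JT N = JT (size la).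
Proof.
move=> h0 le_N JT; rewrite -(subnKC le_N); set m := (N - _)%N; set l := size la.
rewrite {1}/JT; set M := \matrix_(i, j) _.
have la0 i : nth 0%N la (l + i) = 0%N by rewrite nth_default ?leq_addr.
have M0 : dlsubmx M = 0.
  apply/matrixP=> i j; rewrite !mxE /= la0 add0n leqNgt.
  by rewrite (leq_trans (ltn_ord j)) ?leq_addr.
rewrite -[M]submxK M0 det_ublock.
have -> : \det (drsubmx M) = 1.
  rewrite -det_tr det_trig.
    by rewrite big1 // => i _; rewrite !mxE /= la0 add0n leqnn subnn h0.
  apply/is_trig_mxP=> i j lt_ij; rewrite !mxE /= la0 add0n leq_add2l.
  by rewrite leqNgt lt_ij.
by rewrite mulr1; congr (\det _); apply/matrixP=> i j; rewrite !mxE.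
Qed.

Lemma schur_alternant N (x : N.-tuple R) (la : seq nat) :
  (size la <= N)%N ->
  \det (\matrix_(i < N, j < N) tnth x j ^+ (nth 0%N la i + (N.-1 - i))) =
  schur x la * \det (\matrix_(i < N, j < N) tnth x j ^+ (N.-1 - i)).
Proof.
have [c alt_c] := alternant_det x.
have hmxE (mu : seq nat) : (size mu <= N)%N ->
    \det (hmx x (fun i => nth 0%N mu i + (N.-1 - i))%N) = schur x mu.
  move=> le_N; rewrite /schur -(jacobi_trudi_widen (hsym0 x) le_N).
  congr (\det _); apply/matrixP=> i j; rewrite !mxE.
  have [le_i le_j] : (i <= N.-1 /\ j <= N.-1)%N.
    by split; rewrite -ltnS (ltn_predK (ltn_ord i)).
  rewrite leq_subLR addnA [(j + _)%N]addnC addnBA // leq_subRL; last first.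
    exact: leq_trans le_i (leq_addl _ _).
  rewrite leq_add2r; case: ifP => // _; congr hsym.
  by rewrite subnBA // addnAC addnBA // subnAC addnK.
have schur0 : schur x [::] = 1 by rewrite /schur det_mx00.
move=> le_N; rewrite alt_c hmxE //.
rewrite alt_c (_ : \det (hmx x (fun i => N.-1 - i)%N) = 1) ?mul1r //.
rewrite -schur0 -(hmxE [::]) //; congr (\det _); apply/matrixP=> i j.
by rewrite !mxE nth_nil add0n.
Qed.

End Alternant.

(* The alphabets (x, x) and x^2. *)
Definition dup_vars (R : Type) N (x : N.-tuple R) : (N + N).-tuple R :=
  [tuple of x ++ x].
Definition sq_vars (R : pzSemiRingType) N (x : N.-tuple R) : N.-tuple R :=
  [tuple of [seq xi ^+ 2 | xi <- x]].

(* Hall-Littlewood polynomial P_la(x; t), for pairwise distinct x_i :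
   the sum over S_N / S_N^la of
   w (x^la * prod_(la_i > la_j) (x_i - t x_j) / (x_i - x_j)),
   where S_N^la is the stabilizer of la. The sum over cosets is the sum over
   S_N divided by #|S_N^la|, so the characteristic has to be 0. *)
Definition HL_stab N (la : seq nat) : {set 'S_N} :=
  [set w : 'S_N | [forall i, nth 0%N la (w i) == nth 0%N la i]].
Definition HL_P (F : fieldType) N (x : N.-tuple F) (t : F) (la : seq nat) : F :=
  if (size la <= N)%N then
    (\sum_(w : 'S_N)
       (\prod_(i < N) tnth x (w i) ^+ nth 0%N la i) *
       (\prod_(i < N) \prod_(j < N | (nth 0%N la j < nth 0%N la i)%N)
          ((tnth x (w i) - t * tnth x (w j)) /
           (tnth x (w i) - tnth x (w j))))) / #|HL_stab N la|%:R
  else 0.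

(* Q_la = b_la(t) P_la, b_la(t) = prod_(i >= 1) phi_(m_i(la))(t),
   phi_m(t) = (1 - t) (1 - t^2) ... (1 - t^m) *)
Definition HL_b (R : pzRingType) (t : R) (la : seq nat) : R :=
  \prod_(i <- undup la) \prod_(1 <= k < (count_mem i la).+1) (1 - t ^+ k).
Definition HL_Q (F : fieldType) N (x : N.-tuple F) (t : F) (la : seq nat) : F :=
  HL_b t la * HL_P x t la.

Definition schurQ (F : fieldType) N (x : N.-tuple F) (mu : seq nat) : F :=
  HL_Q x (-1) mu.

(* A symmetric function is given by its images in all the Lambda_N, that is, in
   the variables x_1, ..., x_N for every N; these live in C(x_1, ..., x_N). *)
Definition ratfun (C : fieldType) (N : nat) : fieldType :=
  {fraction {mpoly C[N]}}.
Definition ratC (C : fieldType) N (c : C) : ratfun C N := tofrac (c%:MP).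
Definition vars (C : fieldType) N : N.-tuple (ratfun C N) :=
  [tuple tofrac 'X_i | i < N].

(* Main.v *)
Require Import Defs.
From mathcomp Require Import all_boot all_order all_fingroup all_algebra.
From mathcomp Require Import mpoly ring zify.

Set Implicit Arguments.
Unset Strict Implicit.
Unset Printing Implicit Defensive.

Import GRing.Theory Num.Theory.
Local Open Scope ring_scope.

(** Let [q_r] be the coefficients of prod_i (1 + x_i u) / (1 - x_i u). From
      1 / (1 - y u)^2 = (1 + y u) / (1 - y u) * 1 / (1 - y^2 u^2)
    one gets h_k(x,x) = sum_j q_(k-2j)(x) h_j(x^2), so the Jacobi-Trudi
    determinant S_la(x,x) is an integer polynomial in the q_r(x) and the
    h_j(x^2), homogeneous of degree n. Integrality then comes from two facts.

    - A product of complete functions is an integer combination of Schur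
      functions ([prod_complete_in_schur]): in the Jacobi-Trudi expansion of
      S_la every term other than the diagonal one, h_la, is strictly larger
      than h_la for a suitable weight, so the expansion can be inverted.

    - A product of q_r is an integer combination of Q_rho with rho strict
      ([qprod_in_Q]). The Hall-Littlewood sum defining Q_al makes sense for any
      sequence al of positive exponents; it peels off one variable at a time,
        Q_(a, al)(X) = sum_(k in X) 2 x_k^a
             prod_(j in X, j != k) (x_k + x_j) / (x_k - x_j) Q_al(X - x_k).
      By Lagrange interpolation q_r = Q_(r) for r > 0, and the factor of the
      generating function that belongs to x_k is 1 + 2 sum_b x_k^b u^b. Hence
      an induction on al gives
        q_r Q_al = sum_be 2^(number of nonzero be_i) Q_(al + be, r - |be|),
      with the last exponent omitted if it is 0 ([pieriP]). Finally Q_al is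
      alternating in al, so it is 0 or plus or minus Q_rho, rho strict.

    A pair (rho, nu) with rho strict and |rho| + 2 |nu| = n is (mu^r, mu^d) for
    mu the union of rho, nu and nu, which gives integer coefficients.

    For uniqueness it is enough that, in n variables, the products
    Q_(mu^r)(x) S_(mu^d)(x^2), mu in P_n, are linearly independent over C. By
      2 h_m = h_m(x,x) - sum_(0 < i < m) h_i h_(m-i),
      q_m = sum_i e_i h_(m-i)
    the h_m and then the e_m are polynomials over C in the q_r(x) and h_j(x^2).
    So the products e_la, la in P_n, are combinations of the compound
    functions; they are as many, and they are linearly independent by the
    fundamental theorem on symmetric polynomials.

    All these expansions have coefficients that do not depend on the number of
    variables; this is why linear combinations of families indexed by that
    number are considered ([symspan]). *)

(** * Truncated power series *)

Section TruncatedSeries.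
Variable R : comNzRingType.
Implicit Types (n : nat) (p q c : {poly R}) (y a : R).

(** Equality modulo 'X^n.+1: polynomials stand for power series known up to
    degree [n]. *)
Definition eq_upto n p q : Prop := forall i, (i <= n)%N -> p`_i = q`_i.

Lemma eq_upto_trans n p q r : eq_upto n p q -> eq_upto n q r -> eq_upto n p r.
Proof. by move=> pq qr i le_i; rewrite pq ?qr. Qed.

Lemma eq_uptoM n p p' q q' :
  eq_upto n p p' -> eq_upto n q q' -> eq_upto n (p * q) (p' * q').
Proof.
move=> pp qq i le_i; rewrite !coefM; apply: eq_bigr => j _.
have le_j : (j <= i)%N by rewrite -ltnS.
by rewrite pp ?qq // ?(leq_trans _ le_i) ?leq_subr.
Qed.

Lemma eq_upto_prod n (I : Type) (r : seq I) (P : pred I) (f g : I -> {poly R}) :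
  (forall i, P i -> eq_upto n (f i) (g i)) ->
  eq_upto n (\prod_(i <- r | P i) f i) (\prod_(i <- r | P i) g i).
Proof. by move=> fg; elim/big_rec2: _ => // i p q /fg; apply: eq_uptoM. Qed.

(** The coefficients of [p] can be read off one after the other from those of
    [c * p], as [c] is invertible as a power series. *)
Lemma eq_upto_cancel n c p q :
  c`_0 = 1 -> eq_upto n (c * p) (c * q) -> eq_upto n p q.
Proof.
move=> c0 cpq i; elim/ltn_ind: i => i IHi le_i.
have := cpq i le_i; rewrite !coefM !big_ord_recl /= c0 !mul1r subn0.
rewrite (eq_bigr (fun j : 'I_i => c`_(bump 0 j) * q`_(i - bump 0 j))) => [/addIr//|j _].
by rewrite IHi ?(leq_trans (leq_subr _ _)) // ltn_subrL (leq_ltn_trans _ (ltn_ord j)).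
Qed.

Definition lin a : {poly R} := 1 + a *: 'X.
(** [geo] and [qgeo] are the truncations of 1 / (1 - y X) and of
    (1 + y X) / (1 - y X). *)
Definition geo n y : {poly R} := \poly_(i < n.+1) y ^+ i.
Definition qcoef i : nat := if i == 0%N then 1 else 2.
Definition qgeo n y : {poly R} := \poly_(i < n.+1) ((qcoef i)%:R * y ^+ i).

Lemma coef_linM a p i :
  (lin a * p)`_i = p`_i + a * (if i == 0%N then 0 else p`_i.-1).
Proof. by rewrite mulrDl mul1r coefD -scalerAl coefZ coefXM. Qed.

Lemma coef0_lin a : (lin a)`_0 = 1.
Proof. by rewrite coefD coef1 coefZ coefX mulr0 addr0. Qed.

Lemma coef_lin a i : (lin a)`_i = if i == 0%N then 1 else if i == 1%N then a else 0.
Proof.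
rewrite coefD coef1 coefZ coefX; case: i => [|[|i]] /=; rewrite ?mulr0 ?mulr1 ?addr0 ?add0r //.
Qed.

Lemma coef0_prod_lin (I : Type) (r : seq I) (P : pred I) (f : I -> R) :
  (\prod_(i <- r | P i) lin (f i))`_0 = 1.
Proof. by rewrite coef0_prod big1 // => i _; rewrite coef0_lin. Qed.

Lemma geoP n y : eq_upto n (lin (- y) * geo n y) 1.
Proof.
move=> i le_i; rewrite coef_linM coef1 !coef_poly ltnS le_i.
case: i le_i => [|i] le_i /=; first by rewrite mulr0 addr0.
by rewrite ltnS (ltnW le_i) exprS mulNr subrr.
Qed.

Lemma qgeoP n y : eq_upto n (lin (- y) * qgeo n y) (lin y).
Proof.
move=> i le_i; rewrite coef_linM coef_lin !coef_poly ltnS le_i /qcoef.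
case: i le_i => [|[|i]] le_i /=; first by rewrite mulr0 addr0 mul1r.
  by rewrite expr0 expr1 !mulr1 mulr_natl mulrS addrK.
by rewrite ltnS (ltnW le_i) [in X in X + _]exprS mulrCA mulNr subrr.
Qed.

Lemma qgeo_widen m n y : (m <= n)%N -> eq_upto m (qgeo m y) (qgeo n y).
Proof. by move=> le_mn i le_i; rewrite !coef_poly !ltnS le_i (leq_trans le_i). Qed.

(** The identity behind the doubled alphabet: the square of the factor 1 / (1 - y X)
    of the generating function of the h_k is the factor (1 + y X) / (1 - y X) of
    that of the q_r times the factor 1 / (1 - y^2 X^2) coming from y^2. *)
Lemma geo_square n y :
  eq_upto n (geo n y * geo n y) (qgeo n y * (geo n (y ^+ 2) \Po 'X^2)).
Proof.
have lin_sq : lin (- y) * lin y = lin (- y ^+ 2) \Po 'X^2.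
  rewrite /lin comp_polyD comp_polyZ comp_polyX comp_polyC.
  rewrite !scaleNr -subr_sqr expr1n; congr (_ - _).
  by rewrite exprZn.
have geo2P : eq_upto n ((lin (- y) * lin y) * (geo n (y ^+ 2) \Po 'X^2)) 1.
  rewrite lin_sq -comp_polyM => i le_i.
  rewrite coef_comp_poly_Xn // coef1; case: ifP => [i2|].
    rewrite geoP ?coef1 ?(leq_trans (leq_div _ _)) //.
    by case/dvdnP: i2 => j ->; rewrite mulnK // muln_eq0 orbF.
  by case: i {le_i}.
apply: (@eq_upto_cancel n (lin (- y) * lin (- y))); first by rewrite coef0M !coef0_lin mulr1.
rewrite mulrACA; apply: (@eq_upto_trans _ _ (1 * 1)).
  by apply: eq_uptoM; apply: geoP.
rewrite mulrACA mul1r; apply: (@eq_upto_trans _ _ ((lin (- y) * lin y) * (geo n (y ^+ 2) \Po 'X^2))).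
  by move=> i /geo2P->.
rewrite [lin (- y) * lin y]mulrC -[lin y * _ * _]mulrA.
by apply: eq_uptoM => // i le_i; rewrite qgeoP.
Qed.

Lemma hsymE N (x : N.-tuple R) n k :
  (k <= n)%N -> hsym x k = (\prod_(y <- x) geo n y)`_k.
Proof.
elim: N x k => [|N IHN] x k le_k.
  rewrite [x]tuple0 big_nil coef1; case: k le_k => [|k] _.
    by rewrite hsym0.
  by rewrite hsym_nil.
case/tupleP: x => y x; rewrite big_cons.
set p := \prod_(z <- x) _.
have ypE i : (i <= n)%N -> (lin (- y) * (geo n y * p))`_i = p`_i.
  move=> le_i; rewrite mulrA -[in RHS](mul1r p).
  by apply: (eq_uptoM (@geoP n y)).
elim: k le_k => [|k IHk] le_k.
  by have := ypE 0%N le_k; rewrite coef_linM mulr0 addr0 => ->; rewrite hsym0 -IHN ?hsym0.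
have := ypE _ le_k; rewrite coef_linM /= mulNr => /eqP; rewrite subr_eq => /eqP->.
by rewrite hsym_cons (IHN x _ le_k) (IHk (ltnW le_k)).
Qed.

End TruncatedSeries.

(** * Schur's Q-functions for arbitrary exponents *)

Section QFunctions.
Variables (F : fieldType) (I : finType) (x : I -> F).
Implicit Types (A : {set I}) (k j : I) (r n : nat) (al : seq nat).

(** The generating function of [qset A] is the product over [k in A] of
    (1 + x_k u) / (1 - x_k u). *)
Definition qset A r : F := (\prod_(k in A) qgeo r (x k))`_r.

Lemma qsetE A n r : (r <= n)%N -> (\prod_(k in A) qgeo n (x k))`_r = qset A r.
Proof.
move=> le_rn; apply/esym; rewrite /qset.
by apply: (@eq_upto_prod _ r) => // k _; apply: qgeo_widen.
Qed.

Lemma qset0 A : qset A 0 = 1.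
Proof.
rewrite /qset coef0_prod big1 // => k _.
by rewrite coef_poly /qcoef /= mul1r.
Qed.

(** The factor of the generating function belonging to [x k] is split off. *)
Lemma qset_setD1 A k r : k \in A ->
  qset A r = \sum_(b < r.+1) (qcoef b)%:R * x k ^+ b * qset (A :\ k) (r - b).
Proof.
move=> Ak; rewrite /qset (big_setD1 k) //= coefM; apply: eq_bigr => b _.
by rewrite coef_poly ltn_ord qsetE ?leq_subr.
Qed.

Definition qratio (a b : F) : F := (a + b) / (a - b).
Definition qratios A k : F := \prod_(j in A :\ k) qratio (x k) (x j).

Hypotheses (x_inj : injective x) (x_neq0 : forall k, x k != 0).

Lemma lin_qratio k j : j != k ->
  1 + x j * (x k)^-1 = qratio (x k) (x j) * (1 - x j * (x k)^-1).
Proof.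
move=> neq_jk; rewrite /qratio.
have kj : x k - x j != 0 by rewrite subr_eq0 (inj_eq x_inj) eq_sym.
by field; rewrite x_neq0.
Qed.

Lemma size_prod_lin A (f : I -> F) : (size (\prod_(k in A) lin (f k))%R <= #|A|.+1)%N.
Proof.
apply: leq_trans (size_poly_prod_leq _ _) _.
have : (\sum_(k in A) size (lin (f k)) <= \sum_(k in A) 2)%N.
  apply: leq_sum => k _; apply: leq_trans (size_polyD _ _) _.
  rewrite size_poly1 geq_max /=.
  by apply: leq_trans (size_scale_leq _ _) _; rewrite size_polyX.
rewrite sum_nat_const => le_s.
by rewrite leq_subLR; apply: leq_trans (le_s : _.+1 <= _.+1)%N _; rewrite muln2 -addnn addnS.
Qed.

(** Both sides have degree at most [#|A|], and they agree at the [#|A|.+1] points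
    [0] and [(x k)^-1], [k] in [A]: at [(x k)^-1] only the [k]-th term of the sum
    survives. *)
Lemma prod_lin_interpolation A :
  \prod_(k in A) lin (x k) = \prod_(k in A) lin (- x k) +
    \sum_(k in A) (2 * x k * qratios A k) *: ('X * \prod_(j in A :\ k) lin (- x j)).
Proof.
apply/eqP; rewrite -subr_eq0; set p := _ - _; apply/negPn/negP => p_neq0.
pose rs := 0 :: [seq (x k)^-1 | k <- enum A].
have linE a z : (lin a).[z] = 1 + a * z by rewrite !hornerE.
have rs_uniq : uniq rs.
  rewrite /= map_inj_uniq ?enum_uniq ?andbT => [|k j /invr_inj/x_inj//].
  by apply/mapP=> -[k _ /eqP]; rewrite eq_sym invr_eq0 (negPf (x_neq0 k)).
have rs_root : all (root p) rs.
  apply/allP=> z; rewrite inE => /predU1P[->|/mapP[k]].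
    rewrite /root /p !hornerE !horner_prod horner_sum.
    rewrite [X in X - _]big1 => [|k _]; last by rewrite linE mulr0 addr0.
    rewrite [X in _ - (X + _)]big1 => [|k _]; last by rewrite linE mulr0 addr0.
    by rewrite big1 ?addr0 ?subrr // => k _; rewrite hornerZ hornerM hornerX mul0r mulr0.
  rewrite mem_enum => Ak ->{z}.
  rewrite /root /p !hornerE !horner_prod horner_sum.
  rewrite !(big_setD1 k Ak) /= !linE mulNr divff // subrr mul0r add0r.
  rewrite [X in _ - (_ + X)]big1 ?addr0; last first.
    move=> j; rewrite in_setD1 => /andP[neq_jk Aj]; rewrite !hornerE horner_prod.
    by rewrite (big_setD1 k) /= ?in_setD1 1?eq_sym ?neq_jk // linE mulNr divff // subrr !(mul0r, mulr0).
  rewrite hornerZ hornerM hornerX horner_prod subr_eq0; apply/eqP.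
  rewrite (eq_bigr (fun j => qratio (x k) (x j) * (lin (- x j)).[(x k)^-1])).
    by rewrite big_split /=; rewrite -/(qratios A k); field; rewrite x_neq0.
  move=> j; rewrite in_setD1 => /andP[neq_jk _].
  by rewrite !linE lin_qratio // mulNr.
have := max_poly_roots p_neq0 rs_root rs_uniq.
rewrite /= size_map -cardE ltnNge => /negP[].
apply: leq_trans (size_polyD _ _) _; rewrite geq_max size_prod_lin /= size_polyN.
apply: leq_trans (size_polyD _ _) _; rewrite geq_max size_prod_lin /=.
apply: leq_trans (size_sum _ _ _) _; apply/bigmax_leqP=> k Ak.
apply: leq_trans (size_scale_leq _ _) _.
rewrite (leq_trans (size_polyMleq _ _)) // size_polyX /=.
by have := size_prod_lin (A :\ k) (fun j => - x j); rewrite [#|A|](cardsD1 k) Ak.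
Qed.

(** Partial fractions: [prod_lin_interpolation] divided by the product of the
    1 - x_k u reads sum_r q_r u^r = 1 + sum_k 2 x_k u (qratios A k) / (1 - x_k u). *)
Lemma qset_lagrange A r : (0 < r)%N ->
  qset A r = \sum_(k in A) 2 * x k ^+ r * qratios A k.
Proof.
case: r => // r _.
pose L : {poly F} := 1 + \sum_(k in A) (2 * x k * qratios A k) *: ('X * geo r.+1 (x k)).
suff /(_ r.+1 (leqnn _)) : eq_upto r.+1 (\prod_(k in A) qgeo r.+1 (x k)) L.
  rewrite /qset => ->; rewrite coefD coef1 add0r coef_sum; apply: eq_bigr => k _.
  by rewrite coefZ coefXM /= coef_poly ltnS leqnSn exprS; ring.
apply: (@eq_upto_cancel _ _ (\prod_(k in A) lin (- x k))).
  exact: coef0_prod_lin.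
rewrite -big_split /= => i le_i.
transitivity (\prod_(k in A) lin (x k))`_i.
  by apply: (@eq_upto_prod _ r.+1) => // k _; apply: qgeoP.
rewrite prod_lin_interpolation mulrDr mulr1 !coefD; congr (_ + _).
rewrite mulr_sumr !coef_sum; apply: eq_bigr => k Ak.
rewrite -scalerAr !coefZ; congr (_ * _).
rewrite mulrCA !coefXM; case: i le_i => // i le_i /=.
rewrite (big_setD1 k Ak) /= -mulrA mulrCA -[in LHS](mulr1 (\prod_(j in _) _)).
by apply: eq_uptoM (leqnn i) => // j le_j; rewrite geoP // (leq_trans le_j) // ltnW.
Qed.

(** For [al] a strict partition this is Schur's Q-function in the variables of
    [A], see [schurQ_Qset]. Arbitrary exponents are allowed so that [pieriP] holds
    without case distinctions. *)
Fixpoint Qset A al : F :=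
  if al is a :: al' then
    \sum_(k in A) 2 * x k ^+ a * qratios A k * Qset (A :\ k) al'
  else 1.

(** The multiset of exponents, with multiplicities, in the expansion of
    q_r Q_al; the index [b] is the amount added to the first exponent. It depends
    neither on the variables nor on their number. *)
Fixpoint pieri r al : seq (nat * seq nat) :=
  if al is a :: al' then
    flatten [seq [seq ((qcoef b * p.1)%N, (a + b)%N :: p.2) | p <- pieri (r - b) al']
            | b <- iota 0 r.+1]
  else [:: (1%N, if r is 0 then [::] else [:: r])].

Lemma pieri_cons r a al : pieri r (a :: al) =
  flatten [seq [seq ((qcoef b * p.1)%N, (a + b)%N :: p.2) | p <- pieri (r - b) al]
          | b <- iota 0 r.+1].
Proof. by []. Qed.

(** In each summand of [Qset A (a :: al)] the variable [x k] has been taken out of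
    [A], so q_r of [A] is expanded over the powers of [x k] times q_(r - b) of the
    remaining variables, to which the induction hypothesis applies. The Lagrange
    formula is the base case. *)
Lemma pieriP A r al :
  qset A r * Qset A al = \sum_(p <- pieri r al) p.1%:R * Qset A p.2.
Proof.
elim: al A r => [|a al IHal] A r.
  rewrite /= mulr1 big_seq1 mul1r; case: r => [|r] /=; first exact: qset0.
  by rewrite qset_lagrange //; apply: eq_bigr => k _; rewrite mulr1.
rewrite pieri_cons [Qset A _]/= big_flatten big_map -[iota 0 _]/(index_iota 0 r.+1) big_mkord.
under [RHS]eq_bigr => b _.
  rewrite big_map /=; under eq_bigr do rewrite mulr_sumr.
  rewrite exchange_big /=; over.
rewrite exchange_big /= mulr_sumr; apply: eq_bigr => k Ak.
rewrite (qset_setD1 _ Ak) mulr_suml; apply: eq_bigr => b _.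
rewrite mulrACA -mulrA IHal.
rewrite mulr_sumr mulr_sumr; apply: eq_bigr => p _.
by rewrite natrM exprD; ring.
Qed.

Definition positive_seq m al := (0%N \notin al) && (sumn al == m).

(** The exponent 0 never appears: for it the Lagrange formula would fail. *)
Lemma pieri_positive m r al p : positive_seq m al -> p \in pieri r al ->
  positive_seq (r + m)%N p.2.
Proof.
rewrite /positive_seq; elim: al m r p => [|a al IHal] m r p.
  rewrite /= inE => /eqP <- /eqP->.
  by case: r => //= r; rewrite ?addn0 eqxx.
rewrite inE negb_or => /andP[/andP[a_neq0 al_neq0] /eqP<-]; rewrite pieri_cons.
case/flatten_mapP=> b; rewrite mem_iota add0n ltnS => /andP[_ le_br].
case/mapP=> q /(IHal (sumn al)); rewrite al_neq0 eqxx => /(_ isT)/andP[q_neq0 /eqP q_sum] ->.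
rewrite /= inE negb_or q_neq0 q_sum andbT eq_sym addn_eq0 negb_and eq_sym a_neq0 /=.
by apply/eqP; rewrite addnA -{2}(subnKC le_br); ring.
Qed.

(** Exchanging the variables that carry the exponents [a] and [b] only changes the
    sign of the factor (x_k + x_j) / (x_k - x_j). *)
Lemma Qset_swap_head A a b al : Qset A (a :: b :: al) = - Qset A (b :: a :: al).
Proof.
rewrite /=.
under eq_bigr do rewrite mulr_sumr.
under [in RHS]eq_bigr do rewrite mulr_sumr.
rewrite (exchange_big_dep (fun j => j \in A)) /=; last by move=> k j _ /setD1P[].
rewrite -sumrN; apply: eq_bigr => j Aj; rewrite -sumrN.
rewrite [LHS](eq_bigl (fun k => k \in A :\ j)); last first.
  by move=> k; rewrite /= !in_setD1 Aj andbT andbC eq_sym.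
apply: eq_bigr => k; rewrite in_setD1 => /andP[neq_kj Ak].
rewrite !setDDl setUC /qratios.
rewrite (big_setD1 j) /= ?in_setD1 1?eq_sym ?neq_kj // (big_setD1 k (_ : k \in A :\ j)) /= ?in_setD1 ?neq_kj //.
rewrite !setDDl [[set k] :|: _]setUC.
have -> : qratio (x k) (x j) = - qratio (x j) (x k).
  by rewrite /qratio addrC -[x k - _]opprB invrN mulrN.
by ring.
Qed.

Lemma Qset_swap A u a b v :
  Qset A (u ++ a :: b :: v) = - Qset A (u ++ b :: a :: v).
Proof.
elim: u A => [|c u IHu] A; first exact: Qset_swap_head.
by rewrite /= -sumrN; apply: eq_bigr => k _; rewrite IHu mulrN.
Qed.

Lemma Qset_move A u a v w :
  Qset A (u ++ v ++ a :: w) = (-1) ^+ size v * Qset A (u ++ a :: v ++ w).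
Proof.
elim: v u => [|b v IHv] u /=; first by rewrite mul1r.
by rewrite -cat_rcons IHv cat_rcons Qset_swap exprS mulN1r mulrN mulNr.
Qed.

(** Moving the second copy of a repeated exponent next to the first one only changes
    the sign, and then exchanging the two gives [Qset = - Qset]. *)
Lemma Qset_repeated A al : 2%:R != 0 :> F -> ~~ uniq al -> Qset A al = 0.
Proof.
move=> two_neq0; elim: al A => //= a al IHal A.
rewrite negb_and negbK => /orP[|al_rep]; last by rewrite big1 // => k _; rewrite IHal ?mulr0.
case/path.splitPr=> v w; rewrite -/(Qset A (a :: v ++ a :: w)) (Qset_move A [:: a] a v w).
have /eqP := Qset_swap_head A a a (v ++ w).
rewrite -addr_eq0 -mulr2n -mulr_natl mulf_eq0 (negPf two_neq0) /= => /eqP.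
by move=> /= ->; rewrite mulr0.
Qed.

End QFunctions.

(** The sign is the same for all alphabets. *)
Lemma Qset_perm be al : perm_eq al be ->
  exists e : bool, forall (F : fieldType) (I : finType) (x : I -> F) u A,
    Qset x A (u ++ al) = (-1) ^+ e * Qset x A (u ++ be).
Proof.
elim: be al => [|b be IHbe] al.
  by move/perm_nilP->; exists false => F I x u A; rewrite mul1r.
move=> al_be; have : b \in al by rewrite (perm_mem al_be) mem_head.
move=> /path.splitPr al_eq; case: al / al_eq al_be => v w.
rewrite -[b :: w]cat1s perm_catCA /= perm_cons => /IHbe[e eP].
exists (odd (size v) (+) e) => F I x u A.
by rewrite Qset_move -cat_rcons eP cat_rcons mulrA signr_addb signr_odd.
Qed.

(** * Comparison with the Hall-Littlewood sum *)

Section HallLittlewood.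
Variable F : fieldType.

Lemma Qset_oversize (I : finType) (x : I -> F) (A : {set I}) al :
  (#|A| < size al)%N -> Qset x A al = 0.
Proof.
elim: al A => //= a al IHal A lt_A; rewrite big1 // => k Ak.
by rewrite IHal ?mulr0 //; rewrite (cardsD1 k) Ak in lt_A.
Qed.

(** Renaming the variables: this is how the variables left over after taking one out
    are seen both as [x \o lift k] and as a subset of the original ones. *)
Lemma Qset_imset (I J : finType) (f : I -> J) (x : J -> F) (A : {set I}) al :
  injective f -> Qset (x \o f) A al = Qset x (f @: A) al.
Proof.
move=> f_inj.
have imD1 (B : {set I}) k : f @: B :\ f k = f @: (B :\ k).
  apply/setP=> j; rewrite in_setD1; apply/andP/imsetP => [[neq_j]|[i]].
    case/imsetP=> i Bi j_eq; exists i => //; rewrite in_setD1 Bi andbT.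
    by apply: contraNneq neq_j => <-; rewrite j_eq.
  by rewrite in_setD1 => /andP[neq_ik Bi] ->; rewrite (inj_eq f_inj) imset_f.
elim: al A => //= a al IHal A.
rewrite big_imset /=; last by move=> i j _ _ /f_inj.
apply: eq_bigr => k _; rewrite IHal /qratios imD1.
by rewrite big_imset //= => i j _ _ /f_inj.
Qed.

(** A permutation is determined by the image of [ord0] and by a permutation of the
    other points; counting shows that every permutation arises. *)
Lemma sum_perm_lift N (f : 'S_N.+1 -> F) :
  \sum_(w : 'S_N.+1) f w = \sum_(k < N.+1) \sum_(v : 'S_N) f (lift_perm ord0 k v).
Proof.
rewrite pair_bigA /= (reindex (fun p : 'I_N.+1 * 'S_N => lift_perm ord0 p.1 p.2)) //.
apply: onW_bij; apply: inj_card_bij; last first.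
  by rewrite card_prod card_ord !card_Sn factS.
move=> [k v] [k' v'] /= eq_perm.
have eq_k : k = k' by have /permP/(_ ord0) := eq_perm; rewrite !lift_perm_id.
rewrite -{k'}eq_k in eq_perm *; congr (_, _); apply/permP=> j.
have /permP/(_ (lift ord0 j)) := eq_perm; rewrite !lift_perm_lift.
exact: lift_inj.
Qed.

Definition HL_sum N (x : 'I_N -> F) (la : seq nat) : F :=
  \sum_(w : 'S_N)
       (\prod_(i < N) x (w i) ^+ nth 0%N la i) *
       (\prod_(i < N) \prod_(j < N | (nth 0%N la j < nth 0%N la i)%N)
          qratio (x (w i)) (x (w j))).

Definition strict_seq (la : seq nat) := sorted gtn la && (0%N \notin la).

Lemma strict_seq_uniq la : strict_seq la -> uniq la.
Proof. by rewrite /strict_seq gtn_sorted_uniq_geq => /andP[/andP[]]. Qed.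

Lemma strict_seq_nth a la j : strict_seq (a :: la) -> (nth 0%N la j < a)%N.
Proof.
case/andP=> /=; rewrite path_sortedE; last exact: rev_trans ltn_trans.
case/andP=> /allP lt_a _; rewrite inE negb_or eq_sym -lt0n => /andP[a_gt0 _].
have [lt_j|le_j] := ltnP j (size la); last by rewrite nth_default.
by apply: lt_a; rewrite mem_nth.
Qed.

Lemma strict_seq_cons a la : strict_seq (a :: la) -> strict_seq la.
Proof.
by rewrite /strict_seq inE negb_or => /andP[/path_sorted-> /andP[_ ->]].
Qed.

(** Induction on [la]: the permutations [w] with [w ord0 = k] correspond to the
    permutations of the remaining variables, and the first part of [la] is larger
    than all the others, so that it contributes exactly [qratios x setT k]. After
    the parts of [la] are used up, the remaining variables are permuted freely,
    whence the factorial. *)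
Lemma HL_sum_Qset N (x : 'I_N -> F) la : strict_seq la -> (size la <= N)%N ->
  HL_sum x la * 2 ^+ size la = (N - size la)`!%:R * Qset x setT la.
Proof.
elim: la N x => [|a la IHla] N x la_strict le_la.
  rewrite /= subn0 !mulr1 /HL_sum.
  under eq_bigr => w _.
    rewrite !big1 ?mulr1 => [|i _|i _]; [over| |by rewrite nth_nil].
    by rewrite big_pred0 // => j; rewrite !nth_nil.
  by rewrite sumr_const card_Sn.
case: N x le_la => // N x le_la.
rewrite /HL_sum sum_perm_lift /= mulr_sumr mulr_suml.
apply: eq_big => [k|k _]; first by rewrite inE.
have lt_a := strict_seq_nth _ la_strict.
transitivity (x k ^+ a * qratios x setT k * HL_sum (x \o lift k) la * 2 ^+ (size la).+1).
  congr (_ * _); rewrite /HL_sum !mulr_sumr; apply: eq_bigr => v _.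
  rewrite 2!big_ord_recl lift_perm_id mulrACA /=; congr (_ * _ * (_ * _)).
  - rewrite big_mkcond big_ord_recl /= ltnn mul1r.
    rewrite (eq_bigr (fun j => qratio (x k) (x (lift k (v j))))) => [|j _]; last first.
      by rewrite lt_a lift_perm_lift.
    rewrite (reindex_inj (@perm_inj _ v^-1%g)) /=.
    rewrite /qratios (eq_bigl (fun j => j != k)) => [|j]; last by rewrite !inE andbT.
    rewrite (eq_bigr (fun j => qratio (x k) (x (lift k j)))) => [|j _]; last by rewrite permKV.
    symmetry; rewrite (reindex_omap (lift k) (unlift k)) => [|j]; last first.
      by rewrite eq_sym => /unlift_some[j' -> ->].
    by apply: eq_bigl => j; rewrite liftK eqxx eq_sym neq_lift.
  - by apply: eq_bigr => i _; rewrite lift_perm_lift.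
  apply: eq_bigr => i _; rewrite big_mkcond big_ord_recl /= ltnNge ltnW ?lt_a // mul1r.
  by rewrite [RHS]big_mkcond; apply: eq_bigr => j _; rewrite !lift_perm_lift.
rewrite exprS -!mulrA [HL_sum _ _ * _]mulrCA IHla ?(strict_seq_cons la_strict) //.
rewrite Qset_imset; last exact: lift_inj.
have -> : lift k @: setT = setT :\ k.
  apply/setP=> j; rewrite !inE andbT; apply/imsetP/idP => [[i _ ->]|neq_jk].
    by rewrite eq_sym neq_lift.
  by rewrite eq_sym in neq_jk; have [i -> _] := unlift_some neq_jk; exists i.
by rewrite subSS; ring.
Qed.

(** The parts of [la] are distinct and nonzero, so a permutation in the stabilizer
    fixes their positions and permutes the positions of the zeros. *)
Lemma card_HL_stab N la : strict_seq la -> (size la <= N)%N ->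
  #|HL_stab N la| = (N - size la)`!.
Proof.
move=> la_strict le_la.
pose S := [set i : 'I_N | (size la <= i)%N].
have cardS : #|S| = (N - size la)%N.
  rewrite -sum1_card (eq_bigl (fun i : 'I_N => xpredT i && (size la <= i)%N)); last by move=> i; rewrite inE.
  by rewrite -(big_geq_mkord (size la) N xpredT (fun=> 1%N)) sum_nat_const_nat muln1.
rewrite -cardS -card_perm; apply: eq_card => w.
have la_uniq := strict_seq_uniq la_strict.
case/andP: la_strict => la_sorted la_pos.
rewrite inE; apply/forallP/idP => [stab_w|w_on i].
  apply/subsetP=> i; rewrite unfold_in inE; apply: contraNT; rewrite -ltnNge => lt_i.
  have := eqP (stab_w i); have [lt_wi /eqP|le_wi] := ltnP (w i) (size la).
    by rewrite nth_uniq.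
  by rewrite nth_default // => la_i; case/negP: la_pos; rewrite la_i mem_nth.
have [lt_i|le_i] := ltnP i (size la).
  have -> // : w i = i.
  by apply: (out_perm w_on); rewrite inE -ltnNge.
have := perm_closed i w_on; rewrite !inE le_i => le_wi.
by rewrite !nth_default.
Qed.

Lemma schurQ_Qset N (x : N.-tuple F) la :
  (forall m, m.+1%:R != 0 :> F) -> strict_seq la ->
  schurQ x la = Qset (tnth x) setT la.
Proof.
move=> char0 la_strict; rewrite /schurQ /HL_Q /HL_P.
case: leqP => [le_la|lt_la]; last first.
  by rewrite mulr0 Qset_oversize // cardsT card_ord.
rewrite card_HL_stab //.
have fact_neq0 : (N - size la)`!%:R != 0 :> F.
  by case: (_`!) (fact_gt0 (N - size la)).
have la_uniq := strict_seq_uniq la_strict.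
have -> : HL_b (-1) la = 2 ^+ size la :> F.
  rewrite /HL_b undup_id // (eq_big_seq (fun=> 2)) => [|i la_i].
    by rewrite big_const_seq count_predT iter_mulr_1.
  by rewrite count_uniq_mem // la_i big_nat1 expr1 opprK.
set S := bigop.body _ _ _; have -> : S = HL_sum (tnth x) la.
  apply: eq_bigr => w _; congr (_ * _); apply: eq_bigr => i _; apply: eq_bigr => j _.
  by rewrite /qratio mulN1r opprK.
by apply: (mulfI fact_neq0); rewrite -HL_sum_Qset //; field.
Qed.

End HallLittlewood.

(** * Linear combinations uniform in the number of variables *)

Definition symfun (C : fieldType) := forall N, ratfun C N.

Section RatC.
Variables (C : fieldType) (N : nat).
Lemma ratCD (a b : C) : ratC N (a + b) = ratC N a + ratC N b.
Proof. by rewrite /ratC !rmorphD. Qed.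
Lemma ratCM (a b : C) : ratC N (a * b) = ratC N a * ratC N b.
Proof. by rewrite /ratC !rmorphM. Qed.
Lemma ratC0 : ratC N (0 : C) = 0.
Proof. by rewrite /ratC !rmorph0. Qed.
Lemma ratC1 : ratC N (1 : C) = 1.
Proof. by rewrite /ratC !rmorph1. Qed.
Lemma ratCN (a : C) : ratC N (- a) = - ratC N a.
Proof. by rewrite /ratC !rmorphN. Qed.
Lemma ratC_nat m : ratC N (m%:R : C) = m%:R.
Proof. by rewrite /ratC !rmorph_nat. Qed.
End RatC.

Section Span.
Variables (C : fieldType) (A : nzRingType) (phi : {rmorphism A -> C}).
Implicit Types (f g h : symfun C) (G : symfun C -> Prop).

(** Linear combinations with coefficients in [A], acting through [phi]; below [A]
    is [int] for integrality and [C] itself for independence. The coefficient in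
    [Span_lin] is chosen before the number [N] of variables. *)
Inductive symspan G : symfun C -> Prop :=
| Span_gen g of G g : symspan G g
| Span_zero f of (forall N, f N = 0) : symspan G f
| Span_lin c f g h of symspan G f & symspan G g
    & (forall N, h N = ratC N (phi c) * f N + g N) : symspan G h.

Lemma span_ext G f g : (forall N, g N = f N) -> symspan G f -> symspan G g.
Proof.
move=> gf Gf; apply: (Span_lin (c := 1) Gf (Span_zero G (f := fun N => 0) _)) => // N.
by rewrite rmorph1 ratC1 mul1r addr0.
Qed.

Lemma spanD G f g : symspan G f -> symspan G g -> symspan G (fun N => f N + g N).
Proof.
move=> Gf Gg; apply: (Span_lin (c := 1) Gf Gg) => N.
by rewrite rmorph1 ratC1 mul1r.
Qed.

Lemma spanZ G c f : symspan G f -> symspan G (fun N => ratC N (phi c) * f N).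
Proof.
move=> Gf; apply: (Span_lin (c := c) Gf (Span_zero G (f := fun N => 0) _)) => // N.
by rewrite addr0.
Qed.

Lemma spanN G f : symspan G f -> symspan G (fun N => - f N).
Proof.
move/(spanZ (-1)); apply: span_ext => N.
by rewrite rmorphN1 ratCN ratC1 mulN1r.
Qed.

Lemma span_natl G m f : symspan G f -> symspan G (fun N => m%:R * f N).
Proof.
by move/(spanZ m%:R); apply: span_ext => N; rewrite rmorph_nat ratC_nat.
Qed.

Lemma span_sign G (b : bool) f : symspan G f -> symspan G (fun N => (-1) ^+ b * f N).
Proof.
case: b => Gf; [have := spanN Gf | apply: span_ext Gf => N]; last by rewrite mul1r.
by apply: span_ext => N; rewrite mulN1r.
Qed.

Lemma span_sum G (I : eqType) (r : seq I) (P : pred I) (F : I -> symfun C) :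
  (forall i, i \in r -> P i -> symspan G (F i)) -> symspan G (fun N => \sum_(i <- r | P i) F i N).
Proof.
elim: r => [|i r IHr] GF; first by apply: Span_zero => N; rewrite big_nil.
have Gr : symspan G (fun N => \sum_(i <- r | P i) F i N).
  by apply: IHr => j rj; apply: GF; rewrite inE rj orbT.
case Pi: (P i); last by apply: span_ext Gr => N; rewrite big_cons Pi.
apply: span_ext (spanD (GF i (mem_head _ _) Pi) Gr) => N.
by rewrite big_cons Pi.
Qed.

Lemma span_trans G G' f : (forall g, G g -> symspan G' g) -> symspan G f -> symspan G' f.
Proof.
move=> GG'; elim=> [//|g g0|c g g' h _ Gg _ Gg' hE]; first exact: Span_zero.
exact: (Span_lin Gg Gg' hE).
Qed.

Lemma spanM G G' G'' f f' :
  (forall g g', G g -> G' g' -> symspan G'' (fun N => g N * g' N)) ->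
  symspan G f -> symspan G' f' -> symspan G'' (fun N => f N * f' N).
Proof.
move=> GG Gf Gf'; elim: Gf => [g Gg|g g0|c g1 g2 h _ G1 _ G2 hE].
- elim: Gf' => [g' Gg'|g' g0|c g1 g2 h _ G1 _ G2 hE]; first exact: GG.
    by apply: Span_zero => N; rewrite g0 mulr0.
  by apply: (Span_lin (c := c) G1 G2) => N; rewrite hE; ring.
- by apply: Span_zero => N; rewrite g0 mul0r.
by apply: (Span_lin (c := c) G1 G2) => N; rewrite hE; ring.
Qed.

Lemma span_coords (J : finType) (g : J -> symfun C) f :
  symspan (fun f => exists j, forall N, f N = g j N) f ->
  exists a : J -> A, forall N, f N = \sum_j ratC N (phi (a j)) * g j N.
Proof.
elim=> [h [j hE]|h h0|c f1 f2 h _ [a1 a1P] _ [a2 a2P] hE].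
- exists (fun i => (i == j)%:R) => N; rewrite (bigD1 j) //= eqxx rmorph1 ratC1 mul1r hE.
  by rewrite big1 ?addr0 // => i /negPf->; rewrite rmorph0 ratC0 mul0r.
- exists (fun=> 0) => N; rewrite h0 big1 // => i _.
  by rewrite rmorph0 ratC0 mul0r.
exists (fun i => c * a1 i + a2 i) => N; rewrite hE a1P a2P mulr_sumr -big_split /=.
by apply: eq_bigr => i _; rewrite rmorphD rmorphM ratCD ratCM mulrDl mulrA.
Qed.

(** * Products of complete functions in terms of Schur functions *)

Definition prodfam (h : nat -> symfun C) (al : seq nat) : symfun C :=
  fun N => \prod_(a <- al) h a N.

Definition JacobiTrudi (h : nat -> symfun C) (la : seq nat) : symfun C := fun N =>
  \det (\matrix_(i < size la, j < size la)
    if (i <= nth 0%N la i + j)%N then h (nth 0 la i + j - i)%N N else 0).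

Definition strip (al : seq nat) := sort geq [seq a <- al | (0 < a)%N].

Lemma geq_total : total geq. Proof. by move=> a b; apply: leq_total. Qed.
Lemma geq_trans : transitive geq. Proof. exact: rev_trans leq_trans. Qed.

Lemma strip_partition al : is_partition (sumn al) (strip al).
Proof.
apply/and3P; split; first exact: sort_sorted geq_total _.
  by rewrite mem_sort mem_filter.
rewrite /strip (perm_sumn (permEl (perm_sort _ _))); apply/eqP.
by elim: al => //= -[|a] al /= ->.
Qed.

Lemma prodfam_strip (h : nat -> symfun C) al N : (forall N, h 0%N N = 1) ->
  prodfam h (strip al) N = prodfam h al N.
Proof.
move=> h0; rewrite /prodfam (perm_big _ (permEl (perm_sort _ _))) big_filter.
by rewrite big_mkcond; apply: eq_bigr => -[|a].
Qed.

(** Sum of [B ^ a] over the nonzero [a]: for large [B] one larger entry outweighs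
    all the smaller ones together; order and zeros do not matter. *)
Definition weight B (al : seq nat) : nat :=
  (\sum_(a <- al) if a is 0 then 0 else B ^ a)%N.

Lemma weight_strip B al : weight B (strip al) = weight B al.
Proof.
rewrite /weight (perm_big _ (permEl (perm_sort _ _))) big_filter.
by rewrite big_mkcond; apply: eq_bigr => -[|a].
Qed.

(** The indices of the complete functions in the term of the Jacobi-Trudi
    determinant belonging to [s]. *)
Definition shifted (la : seq nat) (s : 'S_(size la)) : seq nat :=
  [seq (nth 0 la i + s i - i)%N | i : 'I_(size la)].

Lemma sumn_shifted (la : seq nat) (s : 'S_(size la)) :
  (forall i : 'I_(size la), i <= nth 0 la i + s i)%N -> sumn (shifted s) = sumn la.
Proof.
move=> s_ok; rewrite /shifted !sumnE big_map big_enum /=.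
apply/eqP; rewrite -(eqn_add2r (\sum_(i < size la) i)%N) -big_split /=.
rewrite (eq_bigr (fun i : 'I_(size la) => nth 0 la i + s i)%N) => [|i _]; last by rewrite subnK.
rewrite big_split /= [X in (_ + X == _)%N](reindex_inj (@perm_inj _ s^-1%g)) /=.
rewrite [X in (_ == X + _)%N](big_nth 0%N) big_mkord; apply/eqP; congr (_ + _)%N.
by apply: eq_bigr => i _; rewrite permKV.
Qed.

(** Let [i] be the first index moved by [s]. Then [i < s i], so the [i]-th index
    increases while the earlier ones are unchanged; as [la] is decreasing, the
    power [B ^ (la_i).+1] exceeds the whole contribution of the places from [i] on
    to the weight of [la]. *)
Lemma weight_shifted B (la : seq nat) (s : 'S_(size la)) :
  sorted geq la -> (size la < B)%N -> s != 1%g ->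
  (weight B la < weight B (shifted s))%N.
Proof.
move=> la_sorted lt_B s_neq1; set l := size la in s s_neq1 *.
have [i0 s_i0] : exists i, s i != i.
  apply/existsP; apply: contraNT s_neq1; rewrite negb_exists => /forallP s1.
  by apply/eqP/permP=> i; rewrite perm1; apply/eqP; rewrite -[_ == _]negbK.
pose i := [arg min_(j < i0 | s j != j) (j : nat)].
have [si i_min] : s i != i /\ forall j : 'I_l, (j < i)%N -> s j = j.
  rewrite /i; case: arg_minnP => // j sj j_min; split=> // k lt_k.
  by apply/eqP; apply: contraTT lt_k => /j_min; rewrite -leqNgt.
have lt_si : (i < s i)%N.
  rewrite ltn_neqAle eq_sym si /=; rewrite leqNgt; apply/negP=> /i_min/perm_inj si_eq.
  by rewrite si_eq eqxx in si.
pose w a := (if a is 0 then 0 else B ^ a)%N.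
have B_gt0 : (0 < B)%N by apply: leq_ltn_trans lt_B.
have w_le a b : (a <= b)%N -> (w a <= B ^ b)%N.
  by case: a => //= a lt_ab; rewrite leq_pexp2l.
have nth_geq j : (i <= j)%N -> (nth 0 la j <= nth 0 la i)%N.
  move=> le_ij; have [lt_j|le_j] := ltnP j (size la); last by rewrite [nth 0%N la j]nth_default.
  exact: (sorted_leq_nth geq_trans (fun=> leqnn _) 0%N la_sorted i j (ltn_ord i) lt_j le_ij).
rewrite /weight /shifted big_map big_enum /= (big_nth 0%N) big_mkord.
rewrite (bigID (fun j : 'I_l => j < i)%N) [X in (_ < X)%N](bigID (fun j : 'I_l => j < i)%N) /=.
rewrite [X in (_ < X + _)%N](eq_bigr (fun j : 'I_l => w (nth 0%N la j))); last first.
  by move=> j /i_min->; rewrite addnK.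
rewrite -/(w _) ltn_add2l.
apply: leq_ltn_trans (_ : (l * B ^ nth 0 la i < _)%N).
  apply: leq_trans (_ : (\sum_(j < l | ~~ (j < i)) B ^ nth 0 la i <= _)%N).
    by apply: leq_sum => j; rewrite -leqNgt => /nth_geq/w_le.
  rewrite sum_nat_const leq_mul2r; apply/orP; right.
  by rewrite -[X in (_ <= X)%N]card_ord max_card.
rewrite (bigD1 i) ?ltnn //=.
apply: leq_trans (leq_addr _ _).
have : (nth 0 la i < nth 0 la i + s i - i)%N by move: lt_si; clear; lia.
case: (_ - _)%N => // a le_a; apply: leq_trans (_ : (B ^ (nth 0 la i).+1 <= _)%N).
  by rewrite expnS ltn_mul2r expn_gt0 B_gt0.
by rewrite leq_pexp2l.
Qed.

Lemma size_le_sumn (al : seq nat) : 0%N \notin al -> (size al <= sumn al)%N.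
Proof.
elim: al => //= a al IHal; rewrite inE negb_or => /andP[a_neq0 /IHal le_al].
by rewrite -add1n leq_add // lt0n eq_sym.
Qed.

Lemma weight_le m (al : seq nat) : (sumn al = m -> weight m.+1 al <= m * m.+1 ^ m)%N.
Proof.
move=> al_m; rewrite -[X in (X * _)%N]al_m sumnE big_distrl /= /weight big_seq [leqRHS]big_seq.
apply: leq_sum => -[|a] al_a //; apply: leq_trans (leq_pmull _ _) => //.
by rewrite leq_pexp2l // -al_m sumnE (big_rem _ al_a) leq_addr.
Qed.

(** The identity permutation contributes [prodfam h la] to the determinant, and the
    other terms have larger weight, so a descending induction on the weight, which
    is bounded in degree [m], inverts the Jacobi-Trudi formula. *)
Lemma prod_complete_in_schur (h : nat -> symfun C) m al :
  (forall N, h 0%N N = 1) -> sumn al = m ->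
  symspan (fun f => exists2 la, is_partition m la & forall N, f N = JacobiTrudi h la N) (prodfam h al).
Proof.
move=> h0 al_m; set G := fun f => _.
suff main k la : is_partition m la -> (m * m.+1 ^ m - weight m.+1 la < k)%N -> symspan G (prodfam h la).
  apply: span_ext (main _ (strip al) _ (leqnn _)); last by rewrite -al_m strip_partition.
  by move=> N; rewrite prodfam_strip.
elim: k la => // k IHk la la_part lt_k.
have /and3P[la_sorted la_pos /eqP la_sum] := la_part.
pose term s : symfun C := fun N => \prod_(i < size la)
  if (i <= nth 0%N la i + (s : 'S__) i)%N then h (nth 0 la i + s i - i)%N N else 0.
have JTE N : JacobiTrudi h la N = \sum_(s : 'S_(size la)) (-1) ^+ s * term s N.
  apply: eq_bigr => s _; congr (_ * _); apply: eq_bigr => i _; rewrite mxE //.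
have term1 N : term 1%g N = prodfam h la N.
  rewrite /prodfam (big_nth 0%N) big_mkord; apply: eq_bigr => i _.
  by rewrite perm1 leq_addl addnK.
have GJT : symspan G (JacobiTrudi h la) by apply: Span_gen; exists la.
have Grest : symspan G (fun N => \sum_(s : 'S_(size la) | s != 1%g) (-1) ^+ s * term s N).
  apply: span_sum => s _ s_neq1; apply: span_sign.
  have [/forallP s_ok|] := boolP [forall i : 'I_(size la), i <= nth 0 la i + s i]%N; last first.
    rewrite negb_forall => /existsP[i /negPf s_i]; apply: Span_zero => N.
    by rewrite /term (bigD1 i) //= s_i mul0r.
  have termE N : term s N = prodfam h (strip (shifted s)) N.
    rewrite prodfam_strip // /prodfam big_map big_enum.
    by apply: eq_bigr => i _; rewrite s_ok.
  apply: span_ext termE (IHk _ _ _).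
    by rewrite -la_sum -(sumn_shifted s_ok) strip_partition.
  rewrite ltnS in lt_k; apply: leq_trans lt_k; rewrite weight_strip.
  rewrite ltn_sub2l //; last first.
    by apply: weight_shifted => //; rewrite ltnS -la_sum size_le_sumn.
  apply: leq_trans (_ : (weight m.+1 (shifted s) <= _)%N).
    by apply: weight_shifted => //; rewrite ltnS -la_sum size_le_sumn.
  by apply: weight_le; rewrite sumn_shifted.
apply: span_ext (spanD GJT (spanN Grest)) => N.
by rewrite JTE (bigD1 1%g) //= odd_perm1 mul1r term1 addrK.
Qed.

End Span.

(** * The two factors of the compound basis *)

Section Vars.
Variables (C : numFieldType) (N : nat).

Lemma tnth_vars (i : 'I_N) : tnth (vars C N) i = tofrac 'X_i.
Proof. by rewrite tnth_mktuple. Qed.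

Lemma vars_inj : injective (tnth (vars C N)).
Proof.
move=> i j; rewrite !tnth_vars => /eqP; rewrite tofrac_eq => /eqP.
move/(congr1 (mcoeff U_(i)%MM)); rewrite !mcoeffXU eqxx.
by case: eqP => // _ /eqP; rewrite oner_eq0.
Qed.

Lemma vars_neq0 (i : 'I_N) : tnth (vars C N) i != 0.
Proof.
rewrite tnth_vars tofrac_eq0; apply/eqP=> /(congr1 (mcoeff U_(i)%MM)) /eqP.
by rewrite mcoeffXU eqxx mcoeff0 oner_eq0.
Qed.

Lemma ratC_inj : injective (@ratC C N).
Proof.
move=> a b /eqP; rewrite /ratC tofrac_eq => /eqP/(congr1 (mcoeff 0%MM)).
by rewrite !mcoeffC eqxx !mulr1.
Qed.

Lemma ratfun_char0 m : m.+1%:R != 0 :> ratfun C N.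
Proof. by rewrite -ratC_nat -(ratC0 C N) (inj_eq ratC_inj) pnatr_eq0. Qed.

End Vars.

Section Compound.
Variables (C : numFieldType) (A : nzRingType) (phi : {rmorphism A -> C}).
Implicit Types (f g h : symfun C) (al be rho nu : seq nat).

Definition qfam r : symfun C := fun N => qset (tnth (vars C N)) setT r.
Definition Qfam al : symfun C := fun N => Qset (tnth (vars C N)) setT al.
Definition hsqfam k : symfun C := fun N => hsym (sq_vars (vars C N)) k.

Definition is_schurQ m f := exists2 rho, strict_seq rho && (sumn rho == m) &
  forall N, f N = schurQ (vars C N) rho.

Definition is_schur_sq m f := exists2 nu, is_partition m nu &
  forall N, f N = schur (sq_vars (vars C N)) nu.

(** [Qfam al] is alternating in [al]: it vanishes if an exponent is repeated, and
    otherwise sorting [al] makes it a Q-function up to sign. *)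
Lemma Qfam_in_Q m al : positive_seq m al -> symspan phi (is_schurQ m) (Qfam al).
Proof.
case/andP=> al_pos /eqP al_m.
have [al_uniq|al_rep] := boolP (uniq al); last first.
  by apply: Span_zero => N; apply: Qset_repeated al_rep; apply: ratfun_char0.
have al_sort : perm_eq al (sort geq al) by rewrite perm_sym (permEl (perm_sort _ _)).
have strict : strict_seq (sort geq al).
  rewrite /strict_seq mem_sort al_pos andbT.
  by rewrite gtn_sorted_uniq_geq sort_uniq al_uniq sort_sorted //; apply: geq_total.
have [e eP] := Qset_perm al_sort.
have Qsort : symspan phi (is_schurQ m) (Qfam (sort geq al)).
  apply: Span_gen; exists (sort geq al).
    by rewrite strict (perm_sumn (permEl (perm_sort _ _))) al_m eqxx.
  by move=> N; rewrite schurQ_Qset //; apply: ratfun_char0.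
apply: span_ext (span_sign e Qsort) => N.
exact: (eP _ _ _ [::] setT).
Qed.

Lemma qprod_in_Q m al : sumn al = m -> symspan phi (is_schurQ m) (prodfam qfam al).
Proof.
move=> al_m.
have : symspan phi (fun f => exists2 be, positive_seq m be & forall N, f N = Qfam be N) (prodfam qfam al).
  elim: al m al_m => [|a al IHal] m /= al_m.
    by apply: Span_gen; exists [::]; rewrite /positive_seq /= -?al_m // => N; rewrite /prodfam big_nil.
  apply: (span_ext (f := fun N => qfam a N * prodfam qfam al N)).
    by move=> N; rewrite /prodfam big_cons.
  apply: (spanM (G := eq (qfam a)) _ (Span_gen _ (erefl _)) (IHal _ (erefl _))).
  move=> _ g <- [be be_pos gE].
  apply: (span_ext (f := fun N => \sum_(p <- pieri a be) p.1%:R * Qfam p.2 N)).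
    by move=> N; rewrite gE /qfam /Qfam pieriP //; [apply: vars_inj | apply: vars_neq0].
  apply: span_sum => p p_in _; apply: span_natl; apply: Span_gen; exists p.2 => //.
  by rewrite -al_m; apply: pieri_positive p_in.
by apply: span_trans => g [be /Qfam_in_Q Qbe gE]; apply: span_ext Qbe => N; rewrite gE.
Qed.

Lemma hsqprod_in_schur_sq m al : sumn al = m -> symspan phi (is_schur_sq m) (prodfam hsqfam al).
Proof.
move=> al_m; apply: span_trans (prod_complete_in_schur phi _ al_m); last by move=> N; rewrite /hsqfam hsym0.
by move=> g [nu nu_part gE]; apply: Span_gen; exists nu.
Qed.

End Compound.

(** * The bijection between mu and the pair of mu^r and mu^d *)

Section Recombine.
Implicit Types (s rho nu : seq nat).

Lemma sorted_blocks (f : nat -> nat) s :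
  sorted geq s -> sorted geq (flatten [seq nseq (f i) i | i <- s]).
Proof.
rewrite !(sorted_pairwise geq_trans); elim: s => //= i s IHs /andP[le_i /IHs s_pw].
rewrite pairwise_cat s_pw andbT; apply/andP; split.
  apply/allrelP=> a b; rewrite mem_nseq => /andP[_ /eqP->] /flatten_mapP[j sj].
  by rewrite mem_nseq => /andP[_ /eqP->]; exact: (allP le_i j sj).
elim: (f i) => //= k ->; rewrite andbT.
by apply/allP=> j; rewrite mem_nseq => /andP[_ /eqP->] /=.
Qed.

Lemma count_blocks (f : nat -> nat) s i : uniq s ->
  count_mem i (flatten [seq nseq (f j) j | j <- s]) = ((i \in s) * f i)%N.
Proof.
elim: s => //= j s IHs /andP[sj /IHs s_count].
rewrite count_cat s_count count_nseq inE /=.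
have [<-|] := eqVneq j i; rewrite in_cons.
  by rewrite (negPf sj) eqxx /= addn0.
by rewrite eq_sym => /negPf->.
Qed.

Lemma geq_anti : antisymmetric geq.
Proof. by move=> a b /andP[? ?]; apply/eqP; rewrite eqn_leq; apply/andP. Qed.

(** The partition [mu] is the union of [rho], [nu] and [nu]: the multiplicity of
    [i] is odd exactly when [i] is a part of [rho], and half of it, rounded down,
    is the multiplicity of [i] in [nu]. *)
Lemma part_rd_onto n m1 m2 rho nu :
  strict_seq rho -> sumn rho = m1 -> is_partition m2 nu -> n = (m1 + 2 * m2)%N ->
  exists mu : intpart n, part_r mu = rho /\ part_d mu = nu.
Proof.
case/andP=> rho_sorted rho_pos rho_sum /and3P[nu_sorted nu_pos /eqP nu_sum] n_eq.
move: rho_sorted; rewrite gtn_sorted_uniq_geq => /andP[rho_uniq rho_sorted].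
pose s := sort geq (rho ++ nu ++ nu).
have s_perm : perm_eq s (rho ++ nu ++ nu) by rewrite (permEl (perm_sort _ _)).
have s_sorted : sorted geq s by apply: sort_sorted geq_total _.
have s_part : is_partition n s.
  apply/and3P; split=> //.
    by rewrite (perm_mem s_perm) !mem_cat !negb_or rho_pos nu_pos.
  by rewrite (perm_sumn s_perm) !sumn_cat rho_sum nu_sum n_eq mul2n addnn.
have s_count i : count_mem i s = ((i \in rho) + (count_mem i nu).*2)%N.
  by rewrite (seq.permP s_perm) !count_cat count_uniq_mem // addnn.
have undup_sorted : sorted geq (undup s).
  exact: (subseq_sorted geq_trans (undup_subseq s) s_sorted).
have [mu mu_s] := parts_onto s_part; exists mu; rewrite mu_s; split.
  apply: (sorted_eq geq_trans geq_anti) => //.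
    by apply: sorted_filter => //; apply: geq_trans.
  apply: uniq_perm => // [|i]; first by rewrite filter_uniq ?undup_uniq.
  rewrite mem_filter mem_undup s_count oddD odd_double addbF oddb.
  have [rho_i|//] := boolP (i \in rho).
  by rewrite (perm_mem s_perm) mem_cat rho_i.
apply: (sorted_eq geq_trans geq_anti) => //; first exact: sorted_blocks.
rewrite /part_d; apply/allP=> i _ /=; rewrite count_blocks ?undup_uniq // mem_undup s_count.
rewrite half_bit_double; apply/eqP.
have [_|s'i] := boolP (i \in s); first by rewrite mul1n.
apply/esym/count_memPn; apply: contra s'i.
by rewrite (perm_mem s_perm) !mem_cat => ->; rewrite !orbT.
Qed.

End Recombine.

(** * Generating function identities for the doubled alphabet *)

Section DoubledAlphabet.
Variables (F : fieldType) (N : nat) (x : N.-tuple F).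

Lemma hsym_dup_qset k : hsym (dup_vars x) k =
  \sum_(i < k.+1) qset (tnth x) setT i *
     (if odd (k - i) then 0 else hsym (sq_vars x) (k - i)./2).
Proof.
rewrite (hsymE _ (leqnn k)) /= big_cat /= -big_split /=.
transitivity (\prod_(y <- x) (qgeo k y * (geo k (y ^+ 2) \Po 'X^2)))`_k.
  by apply: (@eq_upto_prod _ k) => // y _; apply: geo_square.
rewrite big_split /= -(rmorph_prod (comp_poly 'X^2)) coefM; apply: eq_bigr => i _.
have le_i : (i <= k)%N by rewrite -ltnS.
congr (_ * _).
  by rewrite -(@qsetE _ _ _ _ k) // big_tuple; congr (polyseq _)`__; apply: eq_bigl => j; rewrite inE.
rewrite coef_comp_poly_Xn // dvdn2 divn2; case: odd => //=.
rewrite (@hsymE _ _ _ k) ?big_map //.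
by apply: leq_trans (leq_subr i k); rewrite -divn2 leq_div.
Qed.

Lemma hsym_dup k : hsym (dup_vars x) k = \sum_(i < k.+1) hsym x i * hsym x (k - i).
Proof.
rewrite (hsymE _ (leqnn k)) /= big_cat /= coefM; apply: eq_bigr => i _.
by rewrite -!hsymE ?leq_subr // -ltnS.
Qed.

(** The factor (1 + y u) / (1 - y u) is that of the e_i times that of the h_j. *)
Lemma qset_elementary k :
  qset (tnth x) setT k = \sum_(i < k.+1) (\prod_(y <- x) lin y)`_i * hsym x (k - i).
Proof.
transitivity (\prod_(y <- x) (lin y * geo k y))`_k.
  rewrite /qset (eq_bigl predT) => [|j]; last by rewrite inE.
  rewrite -(big_tuple _ _ x predT (fun y => qgeo k y)).
  apply: (@eq_upto_prod _ k) => // y _.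
  apply: (@eq_upto_cancel _ _ (lin (- y))); first exact: coef0_lin.
  move=> i le_i; rewrite qgeoP // mulrCA -[in LHS](mulr1 (lin y)).
  by apply: eq_uptoM (leqnn i) => // j le_j; rewrite geoP // (leq_trans le_j).
rewrite big_split coefM; apply: eq_bigr => i _.
by rewrite -hsymE ?leq_subr.
Qed.

Lemma coef_prod_lin k : (\prod_(y <- x) lin y)`_k =
  \sum_(h : {set 'I_N} | #|h| == k) \prod_(i in h) tnth x i.
Proof.
rewrite big_tuple; under eq_bigr do rewrite /lin addrC.
rewrite bigA_distr coef_sum (bigID (fun h : {set 'I_N} => #|h| == k)) /=.
rewrite [X in _ + X]big1 ?addr0 => [|h].
  apply: eq_bigr => h /eqP h_k; rewrite -big_mkcond /= scaler_prod prodr_const h_k.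
  by rewrite coefZ coefXn eqxx mulr1.
rewrite -big_mkcond /= scaler_prod prodr_const coefZ coefXn eq_sym => /negPf->.
by rewrite mulr0.
Qed.

End DoubledAlphabet.

(** * Expansion in the compound basis *)

Section GradedSpan.
Variables (C : numFieldType) (A : nzRingType) (phi : {rmorphism A -> C}).
Implicit Types (f g h : symfun C) (m : nat).

(** Monomials of degree [m] in the q_r(x), of degree r, and the h_s(x^2), of degree
    2s. *)
Definition is_monomial m f := exists rs ss : seq nat, (sumn rs + 2 * sumn ss = m)%N /\
  forall N, f N = prodfam (@qfam C) rs N * prodfam (@hsqfam C) ss N.
Local Notation spanH m := (symspan phi (is_monomial m)).

Lemma spanH_mul m1 m2 m f g : (m1 + m2 = m)%N ->
  spanH m1 f -> spanH m2 g -> spanH m (fun N => f N * g N).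
Proof.
move=> <-; apply: spanM => {}f {}g [rs [ss [<- fE]]] [rs' [ss' [<- gE]]].
apply: Span_gen; exists (rs ++ rs'), (ss ++ ss'); split.
  by rewrite !sumn_cat mulnDr addnACA.
by move=> N; rewrite fE gE /prodfam !big_cat /= mulrACA.
Qed.

Lemma spanH1 : spanH 0 (fun N => 1).
Proof.
apply: Span_gen; exists [::], [::]; split=> // N.
by rewrite /prodfam !big_nil mulr1.
Qed.

Lemma spanH_prod (I : Type) (r : seq I) (d : I -> nat) (F : I -> symfun C) :
  (forall i, spanH (d i) (F i)) ->
  spanH (\sum_(i <- r) d i)%N (fun N => \prod_(i <- r) F i N).
Proof.
move=> HF; elim: r => [|i r IHr].
  by rewrite big_nil; apply: span_ext spanH1 => N; rewrite big_nil.
rewrite big_cons; apply: span_ext (spanH_mul (erefl _) (HF i) IHr) => N.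
by rewrite big_cons.
Qed.

Lemma spanH_q r : spanH r (@qfam C r).
Proof.
apply: Span_gen; exists [:: r], [::]; rewrite /= !addn0; split=> // N.
by rewrite /prodfam big_nil big_seq1 mulr1.
Qed.

Lemma spanH_hsq k : spanH (2 * k) (@hsqfam C k).
Proof.
apply: Span_gen; exists [::], [:: k]; rewrite /= !addn0; split=> // N.
by rewrite /prodfam big_nil big_seq1 mul1r.
Qed.

Definition hdup k : symfun C := fun N => hsym (dup_vars (vars C N)) k.

Lemma spanH_hdup k : spanH k (hdup k).
Proof.
apply: span_ext (fun N => hsym_dup_qset (vars C N) k) _.
apply: span_sum => i _ _.
have le_i : (i <= k)%N by rewrite -ltnS.
case: (boolP (odd (k - i))) => [_|even_ki].
  by apply: Span_zero => N; rewrite mulr0.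
apply: (spanH_mul (m1 := i) (m2 := 2 * (k - i)./2)); last exact: spanH_hsq.
  by rewrite mul2n even_halfK // subnKC.
exact: spanH_q.
Qed.

Lemma spanH_JacobiTrudi (h : nat -> symfun C) (la : seq nat) :
  (forall k, spanH k (h k)) -> spanH (sumn la) (JacobiTrudi h la).
Proof.
move=> Hh; apply: span_sum => s _ _; apply: span_sign.
have [/forallP s_ok|] := boolP [forall i : 'I_(size la), i <= nth 0 la i + (s : 'S__) i]%N; last first.
  rewrite negb_forall => /existsP[i /negPf s_i]; apply: Span_zero => N.
  by rewrite (bigD1 i) //= mxE s_i mul0r.
rewrite -(sumn_shifted s_ok) sumnE /shifted big_map big_enum.
apply: span_ext (spanH_prod _ (fun i : 'I_(size la) => Hh (nth 0 la i + s i - i)%N)) => N.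
by apply: eq_bigr => i _; rewrite mxE s_ok.
Qed.

Definition compound n (mu : intpart n) : symfun C := fun N =>
  schurQ (vars C N) (part_r mu) * schur (sq_vars (vars C N)) (part_d mu).

Lemma spanH_compound n f : spanH n f ->
  exists a : intpart n -> A, forall N, f N = \sum_mu ratC N (phi (a mu)) * compound mu N.
Proof.
move=> Hf; apply: span_coords; apply: span_trans Hf => g [rs [ss [n_eq gE]]].
apply: span_ext gE _.
apply: (spanM _ (qprod_in_Q phi (erefl (sumn rs))) (hsqprod_in_schur_sq phi (erefl (sumn ss)))).
move=> q s [rho /andP[rho_strict /eqP rho_sum] qE] [nu nu_part sE].
have [mu [mu_r mu_d]] := part_rd_onto rho_strict rho_sum nu_part (esym n_eq).
by apply: Span_gen; exists mu => N; rewrite /compound mu_r mu_d qE sE.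
Qed.

End GradedSpan.

(** * Linear independence of the compound basis *)

Section Independence.
Variable C : numFieldType.
Local Notation spanH m := (symspan (idfun : {rmorphism C -> C}) (is_monomial m)).

Definition hfam k : symfun C := fun N => hsym (vars C N) k.
Definition efam k : symfun C := fun N => tofrac (mesym N C k).

(** In h_k(x,x) = sum_i h_i(x) h_(k-i)(x) the terms [i = 0] and [i = k] give twice
    h_k(x); here the division by 2 requires coefficients in [C]. *)
Lemma spanH_hfam k : spanH k (hfam k).
Proof.
elim/ltn_ind: k => -[_|k IHk].
  by apply: span_ext (spanH1 _) => N; rewrite /hfam hsym0.
have Hmid : spanH k.+1 (fun N => \sum_(i < k) hfam i.+1 N * hfam (k - i) N).
  apply: span_sum => i _ _; apply: (spanH_mul (m1 := i.+1) (m2 := k - i)).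
  - by rewrite addSn subnKC // ltnW.
  - by apply: IHk; rewrite ltnS.
  by apply: IHk; rewrite ltnS leq_subr.
apply: span_ext (spanZ 2^-1 (spanD (spanH_hdup _ k.+1) (spanN Hmid))) => N /=.
rewrite /hdup hsym_dup big_ord_recl big_ord_recr /= /bump /= subnn !hsym0 subn0 mul1r mulr1.
under eq_bigr => i _ do rewrite add1n subSS.
rewrite -/(hfam k.+1 N) [_ + hfam _ _]addrC addrA addrK.
have two_neq0 : ratC N (2 : C) != 0 by rewrite ratC_nat; apply: ratfun_char0.
apply: (mulfI two_neq0); rewrite mulrA -ratCM divff ?pnatr_eq0 // ratC1 mul1r.
by rewrite ratC_nat mulr_natl mulr2n.
Qed.

Lemma efamE k N : efam k N = (\prod_(y <- vars C N) lin y)`_k.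
Proof.
rewrite coef_prod_lin /efam /mesym rmorph_sum; apply: eq_bigr => h _.
by rewrite rmorph_prod; apply: eq_bigr => i _; rewrite tnth_vars.
Qed.

Lemma spanH_efam k : spanH k (efam k).
Proof.
elim/ltn_ind: k => k IHk.
have Hlow : spanH k (fun N => \sum_(i < k) efam i N * hfam (k - i) N).
  apply: span_sum => i _ _; apply: (spanH_mul (m1 := i) (m2 := k - i)).
  - by rewrite subnKC // ltnW.
  - exact: IHk.
  exact: spanH_hfam.
apply: span_ext (spanD (spanH_q _ k) (spanN Hlow)) => N.
rewrite /qfam qset_elementary big_ord_recr /= subnn hsym0 mulr1 -efamE.
under [X in X + _ - _]eq_bigr => i _ do rewrite -efamE.
by rewrite addrAC subrr add0r.
Qed.

Lemma spanH_eprod n (la : intpart n) : spanH n (prodfam efam la).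
Proof.
have /and3P[_ _ /eqP la_sum] := parts_partition la.
rewrite -[X in spanH X]la_sum sumnE.
exact: (spanH_prod _ spanH_efam).
Qed.

(** The padded list is the decreasing rearrangement of the parts and of as many zeros
    as are needed to reach length [n]. *)
Lemma parts_inj n : injective (@parts n).
Proof.
move=> la mu eq_parts.
have padP (nu : intpart n) :
    perm_eq (map val (padded nu)) (parts nu ++ nseq (n - size (parts nu)) 0%N).
  rewrite perm_sym -(permPr (permEl (perm_filterC (fun i => 0 < i)%N _))) perm_cat2l.
  set zs := [seq _ <- _ | _].
  have /all_pred1P-> : all (pred1 0%N) zs.
    by apply/allP=> i; rewrite mem_filter /= -eqn0Ngt => /andP[].
  rewrite size_filter /parts size_filter.
  by rewrite -[X in (X - _)%N](size_tuple (padded nu)) -(size_map val) -(count_predC (fun i => 0 < i)%N) addKn.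
have pad_sorted (nu : intpart n) : sorted geq (map val (padded nu)).
  by case: nu => t /= /andP[].
have : map val (padded la) = map val (padded mu).
  apply: (sorted_eq geq_trans geq_anti) => //.
  by rewrite (permPl (padP la)) eq_parts perm_sym; apply: padP.
by move/(inj_map val_inj)/val_inj/val_inj.
Qed.

Definition multiplicities n (la : intpart n) : 'X_{1..n} :=
  [multinom count_mem i.+1 la | i < n].

Lemma part_bound n (la : intpart n) a : a \in parts la -> (0 < a <= n)%N.
Proof.
have /and3P[_ la_pos /eqP la_sum] := parts_partition la => la_a.
rewrite lt0n; apply/andP; split; first by apply: contraNneq la_pos => <-.
by rewrite -[X in (_ <= X)%N]la_sum sumnE (big_rem _ la_a) leq_addr.
Qed.

Lemma multiplicities_inj n : injective (@multiplicities n).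
Proof.
move=> la mu /mnmP eq_mult; apply: parts_inj.
have sorted_parts nu : sorted geq (@parts n nu) by have /and3P[] := parts_partition nu.
apply: (sorted_eq geq_trans geq_anti) => //; apply/allP=> a.
rewrite mem_cat => la_a; apply/eqP.
have /andP[a_gt0 a_le] : (0 < a <= n)%N by case/orP: la_a => /part_bound.
have a_lt : (a.-1 < n)%N by rewrite prednK.
by have := eq_mult (Ordinal a_lt); rewrite !mnmE /= prednK.
Qed.

Lemma prod_multiplicities n (R : comPzRingType) (f : nat -> R) (s : seq nat) :
  {in s, forall a, (0 < a <= n)%N} ->
  \prod_(a <- s) f a = \prod_(i < n) f i.+1 ^+ count_mem i.+1 s.
Proof.
elim: s => [|a s IHs] s_ok; first by rewrite big_nil big1.
have /andP[a_gt0 a_le] : (0 < a <= n)%N by apply: s_ok; rewrite mem_head.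
have a_lt : (a.-1 < n)%N by rewrite prednK.
rewrite big_cons IHs => [|b s_b]; last by apply: s_ok; rewrite inE s_b orbT.
under [RHS]eq_bigr => i _ do rewrite /= exprD.
rewrite big_split /=; congr (_ * _); rewrite (bigD1 (Ordinal a_lt)) //= prednK // eqxx.
rewrite big1 ?mulr1 // => i /eqP neq_i; case: eqP => // a_eq.
by case: neq_i; apply: val_inj; rewrite /= a_eq.
Qed.

(** The products of elementary functions are the images of distinct monomials under
    the substitution of the elementary functions, which is injective. *)
Lemma eprod_free n (c : intpart n -> C) :
  \sum_la ratC n (c la) * prodfam efam la n = 0 -> forall la, c la = 0.
Proof.
move=> c0.
pose t : {mpoly C[n]} := \sum_la c la *: 'X_[multiplicities la].
have t0 : t = 0.
  apply: msym_fundamental_un0; apply/eqP; rewrite -tofrac_eq0 -c0; apply/eqP.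
  rewrite [t \mPo _]rmorph_sum rmorph_sum; apply: eq_bigr => la _.
  rewrite /= linearZ /= -mul_mpolyC rmorphM; congr (_ * _).
  rewrite comp_mpolyX rmorph_prod /prodfam.
  rewrite (prod_multiplicities (n := n)); last by move=> a; apply: part_bound.
  by apply: eq_bigr => i _; rewrite rmorphXn tnth_mktuple mnmE.
move=> la; have := congr1 (mcoeff (multiplicities la)) t0.
rewrite mcoeff0 raddf_sum (bigD1 la) //= mcoeffZ mcoeffX eqxx mulr1 big1 ?addr0 // => mu neq_mu.
by rewrite mcoeffZ mcoeffX (inj_eq (@multiplicities_inj n)) (negPf neq_mu) mulr0.
Qed.

(** The products of elementary functions are independent and are combinations of
    the compound functions; both are indexed by the partitions of [n], so the
    square matrix of these combinations is invertible. *)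
Lemma compound_free n (c : intpart n -> C) :
  \sum_mu ratC n (c mu) * compound C mu n = 0 -> forall mu, c mu = 0.
Proof.
move=> c0.
have /fin_all_exists[M ME] (la : intpart n) := spanH_compound (spanH_eprod la).
pose Mx := \matrix_(i, j) M (enum_val i) (enum_val j) : 'M[C]_#|{: intpart n}|.
have combE (v : 'rV_#|{: intpart n}|) :
    \sum_la ratC n (v 0 (enum_rank la)) * prodfam efam la n =
    \sum_mu ratC n ((v *m Mx) 0 (enum_rank mu)) * compound C mu n.
  under eq_bigr do rewrite ME mulr_sumr.
  rewrite exchange_big /=; apply: eq_bigr => mu _.
  rewrite mxE (reindex _ (onW_bij _ (@enum_rank_bij (intpart n)))) /=.
  rewrite (big_morph _ (@ratCD C n) (@ratC0 C n)) mulr_suml; apply: eq_bigr => la _.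
  by rewrite mxE !enum_rankK ratCM mulrA.
have Mx_unit : Mx \in unitmx.
  rewrite -row_free_unit; apply: inj_row_free => v vM0.
  apply/rowP=> i; rewrite mxE -(enum_valK i).
  apply: (eprod_free (c := fun la => v 0 (enum_rank la))).
  by rewrite combE vM0 big1 // => mu _; rewrite mxE ratC0 mul0r.
pose cv : 'rV_#|{: intpart n}| := \row_j c (enum_val j).
have dv0 : cv *m invmx Mx = 0.
  apply/rowP=> i; rewrite [RHS]mxE -(enum_valK i).
  apply: (eprod_free (c := fun la => (cv *m invmx Mx) 0 (enum_rank la))).
  rewrite combE mulmxKV // -[RHS]c0; apply: eq_bigr => mu _.
  by rewrite mxE enum_rankK.
have cv0 : cv = 0 by rewrite -(mulmxKV Mx_unit cv) dv0 mul0mx.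
by move=> mu; have /rowP/(_ (enum_rank mu)) := cv0; rewrite !mxE enum_rankK.
Qed.

End Independence.

Theorem theorem4p3 (C : numClosedFieldType) (n : nat) :
  let compound_expansion (a : intpart n -> intpart n -> C) : Prop :=
    forall (N : nat) (la : intpart n),
      schur (dup_vars (vars C N)) la =
      \sum_(mu : intpart n)
        ratC N (a la mu) * schurQ (vars C N) (part_r mu)
                         * schur (sq_vars (vars C N)) (part_d mu)
  in
  exists a : intpart n -> intpart n -> C,
    [/\ compound_expansion a,
        forall b, compound_expansion b -> b =2 a
      & forall la mu, exists z : int, a la mu = z%:~R].
Proof.
move=> compound_expansion.
have Hschur (la : intpart n) :
    symspan (intr : {rmorphism int -> C}) (is_monomial n) (JacobiTrudi (@hdup C) la).
  have /and3P[_ _ /eqP la_sum] := parts_partition la.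
  by rewrite -[X in is_monomial X]la_sum; apply: spanH_JacobiTrudi; apply: spanH_hdup.
have /fin_all_exists[z zE] (la : intpart n) := spanH_compound (Hschur la).
have a_exp : compound_expansion (fun la mu => (z la mu)%:~R).
  move=> N la; rewrite -[LHS]/(JacobiTrudi (@hdup C) la N) zE.
  by apply: eq_bigr => mu _; rewrite mulrA.
exists (fun la mu => (z la mu)%:~R); split=> // [b b_exp la mu|la mu]; last by exists (z la mu).
apply/eqP; rewrite -subr_eq0; apply/eqP; move: mu.
apply: compound_free.
under eq_bigr do rewrite ratCD ratCN mulrBl.
rewrite sumrB; apply/eqP; rewrite subr_eq0; apply/eqP.
transitivity (schur (dup_vars (vars C n)) la); last by rewrite -zE.
by rewrite (b_exp n la); apply: eq_bigr => mu _; rewrite mulrA.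
Qed.
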